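(* Let $F$ be a finite simple graph without isolated nodes. If $F$ is not weakly locally common, then $F$ has two odd cycles with at most one node in common, of lengths $g_1$ and $g_2$, such that either $g_1<g_2$ and $g_1+g_2\le g_{\mathrm{even}}(F)$, or $g_1=g_2$ and $g_1+g_2<g_{\mathrm{even}}(F)$.
   Context: A kernel is a bounded measurable symmetric function $W:[0,1]^2\to\mathbb{R}$. Let $\mathcal{W}_1$ denote the set of kernels with values in $[-1,1]$. For a finite simple graph $F$ and a kernel $W$, define $$t(F,W)=\int_{[0,1]^{V(F)}}\prod_{ij\in E(F)}W(x_i,x_j)\prod_{i\in V(F)}dx_i .$$ Here $1\pm\varepsilon U$ denotes the kernel $(x,y)\mapsto 1\pm\varepsilon U(x,y)$. A simple graph $F$ is weakly locally common if for every $U\in\mathcal{W}_1$ there is an $\varepsilon_U>0$ such that $t(F,1+\varepsilon U)+t(F,1-\varepsilon U)\ge 2$ for all $0\le\varepsilon\le\varepsilon_U$. $g_{\mathrm{even}}(F)$ denotes the length of the shortest even cycle of $F$ (a cycle being a subgraph of $F$), with $g_{\mathrm{even}}(F)=\infty$ if $F$ has no even cycle. *)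

(* Defs.v *)
From HB Require Import structures.
From mathcomp Require Import all_boot all_order all_algebra.
From mathcomp Require Import all_classical all_reals all_analysis.

Set Implicit Arguments.
Unset Strict Implicit.
Unset Printing Implicit Defensive.

Import Order.TTheory GRing.Theory Num.Theory.
Import numFieldNormedType.Exports.

Local Open Scope classical_set_scope.
Local Open Scope ring_scope.

Section tuple_measure.
Context (d : measure_display) (T : measurableType d) (R : realType).
Variable mu : {sigma_finite_measure set T -> \bar R}.

Definition tcons n (p : T * n.-tuple T) : n.+1.-tuple T :=
  [tuple of p.1 :: p.2].

Lemma measurable_tcons n : measurable_fun [set: T * n.-tuple T] (@tcons n).
Proof. exact: (measurable_cons measurable_fst measurable_snd). Qed.

Lemma measurable_box n (A : 'I_n -> set T) : (forall i, measurable (A i)) ->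
  measurable [set x : n.-tuple T | forall i, A i (tnth x i)].
Proof.
move=> mA; rewrite [X in measurable X](_ : _ =
    \bigcap_(i in [set: 'I_n]) ((fun x : n.-tuple T => tnth x i) @^-1` A i)).
  apply: fin_bigcap_measurable => // i _.
  by rewrite -[X in measurable X]setTI; exact: measurable_tnth.
by apply/seteqP; split=> x /= xA i; [move=> _; exact: xA|exact: (xA i I)].
Qed.

Lemma tcons_box n (A : 'I_n.+1 -> set T) :
  @tcons n @^-1` [set x : n.+1.-tuple T | forall i, A i (tnth x i)] =
  A ord0 `*` [set x : n.-tuple T | forall i, A (lift ord0 i) (tnth x i)].
Proof.
apply/seteqP; split=> -[a x] /=.
  move=> xA; split=> [|i]; first by have := xA ord0; rewrite tnth0.
  by have := xA (lift ord0 i); rewrite tnthS.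
move=> [Aa Ax] i; case: (unliftP ord0 i) => [j ->|->].
  by rewrite tnthS.
by rewrite tnth0.
Qed.

Section tuple_measureS.
Context (n : nat) (nu : {sigma_finite_measure set (n.-tuple T) -> \bar R}).

Definition tuple_measureS_fun : set (n.+1.-tuple T) -> \bar R :=
  pushforward (mu \x nu)%E (@tcons n).

Let nuS0 : tuple_measureS_fun set0 = 0%E.
Proof. by apply: measure0 => //; exact: measurable_tcons. Qed.

Let nuS_ge0 A : (0 <= tuple_measureS_fun A)%E.
Proof. by apply: measure_ge0; exact: measurable_tcons. Qed.

Let nuS_sigma_additive : semi_sigma_additive tuple_measureS_fun.
Proof. by apply: measure_semi_sigma_additive; exact: measurable_tcons. Qed.

HB.instance Definition _ := isMeasure.Build _ _ _ tuple_measureS_fun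
  nuS0 nuS_ge0 nuS_sigma_additive.

Let tbehead (x : n.+1.-tuple T) : T * n.-tuple T :=
  (thead x, [tuple of behead x]).

Let tconsK : cancel (@tcons n) tbehead.
Proof. by move=> [a x]; congr pair; exact: val_inj. Qed.

Let tbeheadK : cancel tbehead (@tcons n).
Proof. by move=> x; rewrite [RHS]tuple_eta. Qed.

Let measurable_tbehead : measurable_fun setT tbehead.
Proof.
apply/measurable_fun_pair; first exact: measurable_tnth.
exact: measurable_behead.
Qed.

Let nuS_sigma_finite : sigma_finite setT tuple_measureS_fun.
Proof.
have /sigma_finiteP[F [TF ndF Foo]] := sigma_finiteT mu.
have /sigma_finiteP[G [TG ndG Goo]] := sigma_finiteT nu.
exists (fun k => tbehead @^-1` (F k `*` G k)).
  rewrite -preimage_bigcup (_ : \bigcup_k _ = setT) // -subTset => -[x y] _.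
  have [i _ Fx] : (\bigcup_k F k) x by rewrite -TF.
  have [j _ Gy] : (\bigcup_k G k) y by rewrite -TG.
  exists (maxn i j) => //; split.
    by move: x Fx; exact/subsetPset/ndF/leq_maxl.
  by move: y Gy; exact/subsetPset/ndG/leq_maxr.
move=> k; have [mF Fk] := Foo k; have [mG Gk] := Goo k; split.
  by rewrite -[X in measurable X]setTI; apply: measurable_tbehead => //;
    exact: measurableX.
rewrite /tuple_measureS_fun /pushforward -comp_preimage.
rewrite (_ : tbehead \o _ = id); last by apply/funext => x; exact: tconsK.
by rewrite preimage_id product_measure1E // lte_mul_pinfty // ge0_fin_numE.
Qed.

HB.instance Definition _ := Measure_isSigmaFinite.Build _ _ _ tuple_measureS_fun
  nuS_sigma_finite.

Definition tuple_measureS : {sigma_finite_measure set (n.+1.-tuple T) -> \bar R}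
  := tuple_measureS_fun.

End tuple_measureS.

(* The n-fold product measure of mu on n.-tuple T; see tuple_measure_box. *)
Fixpoint tuple_measure n : {sigma_finite_measure set (n.-tuple T) -> \bar R} :=
  match n with
  | 0 => dirac [tuple]
  | n.+1 => tuple_measureS (tuple_measure n)
  end.

Lemma tuple_measure_box n (A : 'I_n -> set T) : (forall i, measurable (A i)) ->
  tuple_measure n [set x | forall i, A i (tnth x i)] =
  (\prod_(i < n) mu (A i))%E.
Proof.
elim: n A => [|n IHn] A mA.
  by rewrite big_ord0 /= diracE mem_set // => -[].
rewrite big_ord_recl -IHn; last by move=> i; exact: mA.
rewrite -[LHS]/((mu \x tuple_measure n)%E (@tcons n @^-1` _)) tcons_box.
rewrite product_measure1E //.
by apply: (@measurable_box n (fun i => A (lift ord0 i))) => i; exact: mA.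
Qed.

End tuple_measure.

(* A kernel is represented by a function on the plane of which only the
   restriction to the unit square is constrained or used; measurable means
   Borel measurable. *)
Record is_kernel (R : realType) (W : R * R -> R) : Prop := IsKernel {
  kernel_measurable :
    measurable_fun (`[0, 1] `*` `[0, 1] : set (R * R)) W;
  kernel_sym : forall x y : R, x \in `[0, 1] -> y \in `[0, 1] ->
    W (x, y) = W (y, x);
  kernel_bounded : exists M : R, forall x y : R,
    x \in `[0, 1] -> y \in `[0, 1] -> `|W (x, y)| <= M }.

Definition in_W1 (R : realType) (W : R * R -> R) : Prop :=
  is_kernel W /\
  forall x y : R, x \in `[0, 1] -> y \in `[0, 1] -> -1 <= W (x, y) <= 1.

Record sgraph := SGraph {
  vert :> finType;
  adj : rel vert;
  adj_sym : symmetric adj;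
  adj_irrefl : irreflexive adj }.

Definition no_isolated (F : sgraph) : Prop :=
  forall v : F, exists u : F, adj v u.

(* Coordinates are indexed by V(F) through enum_rank; each edge {i, j} is
   taken once, with its endpoints in increasing rank. *)
Definition hom_density (R : realType) (F : sgraph) (W : R * R -> R) : R :=
  \int[tuple_measure lebesgue_measure #|F|]_(x in
      [set x : #|F|.-tuple R | forall k, tnth x k \in `[0, 1]])
    \prod_(p : F * F | adj p.1 p.2 && (enum_rank p.1 < enum_rank p.2)%N)
      W (tnth x (enum_rank p.1), tnth x (enum_rank p.2)).

Definition weakly_locally_common (R : realType) (F : sgraph) : Prop :=
  forall U : R * R -> R, in_W1 U ->
  exists2 epsU : R, 0 < epsU & forall eps : R, 0 <= eps <= epsU ->
    hom_density F (fun p => 1 + eps * U p) +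
    hom_density F (fun p => 1 - eps * U p) >= 2.

(* A cycle of length size c, listed in cyclic order from some vertex. *)
Definition is_cycle (F : sgraph) (c : seq F) : bool :=
  (2 < size c)%N && ucycleb (@adj F) c.

(* The infimum of the empty set is +oo. *)
Definition g_even (R : realType) (F : sgraph) : \bar R :=
  ereal_inf [set (size c)%:R%:E | c in [set c : seq F |
    is_cycle c && ~~ odd (size c)]].

(* Main.v *)
Require Import Defs.
From mathcomp Require Import all_boot all_order all_algebra.
From mathcomp Require Import all_classical all_reals all_analysis.
From mathcomp Require Import measurable_realfun ring lra zify.

(** Write [t S] for the density of the subgraph with edge set [S]. Expanding the
two products gives
  [t(F, 1 + e U) + t(F, 1 - e U) = 2 + 2 * sum of e ^ |S| * t S]
over the nonempty edge sets [S] of even size, so for small [e] the sign is that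
of the lowest order at which some [t S] survives ([eventually_ge0]). Assuming
that the required pair of odd cycles does not exist, one shows that all terms of
that order are nonnegative and one of them is positive, or that all terms of all
orders vanish ([lowest_coefficient]).

Order two. Two edges with a common end have density [\int d^2], where
[d x = \int U(x, y) dy] is the degree of the kernel, and two disjoint edges have
density [(\int d)^2]. Suppose that all these vanish. If some two edges of [F] meet
then [\int d^2 = 0], and every [S] with a vertex of degree one has [t S = 0]; if
no two edges meet then [\int d = 0] and every [t S] vanishes.

Higher order. It remains to consider leafless [S], those where every covered
vertex has degree at least two. A leafless graph of even size has an even cycle or
two odd cycles with at most one common vertex ([even_leafless_cycles]): starting
from an odd cycle, a maximal path outside of it closes up at both ends, and an ear
attached at two different vertices of an odd cycle creates an even cycle. If [S]
has at most [g] edges, [g] the even girth of [F], then counting edges leaves two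
possibilities: [S] is an even cycle of length [g], or it consists of two odd cycles
of length [g / 2] ([critical_leafless]). In particular there are no leafless [S]
of fewer edges. Both kinds have nonnegative density, since integrating out all
but one or two vertices leaves the average of a square, or the square of an
average ([cube_mean_even_cycle], [cube_mean_two_cycles_ge0]).

Finally the shortest even cycle has positive density unless everything vanishes:
if it has density zero then a power of the self-adjoint operator [T] with kernel
[U] is zero, hence [T] is zero ([kernel_op_eq0]), and this kills every [t S] with
[S] nonempty ([cube_mean_edges_weight_eq0]).

All null-set arguments are replaced by a Cauchy-Schwarz argument for averages
([mean_sqr_eq0]): a bounded function whose square has average zero has average
zero against every bounded function. *)

Set Implicit Arguments.
Unset Strict Implicit.
Unset Printing Implicit Defensive.

Import Order.TTheory GRing.Theory Num.Theory.
Import numFieldNormedType.Exports.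

Local Open Scope ring_scope.

(** * Bounded measurable functions on probability spaces *)

Section BoundedMeasurable.
Local Open Scope classical_set_scope.
Local Open Scope ring_scope.
Context {R : realType}.

(** Bounded measurable functions are closed under all the operations below and are
    integrable over every set of measure one, so no integrability condition ever
    has to be tracked. *)
Definition bmeas d (T : measurableType d) (f : T -> R) : Prop :=
  measurable_fun [set: T] f /\ exists M, forall x, `|f x| <= M.

Section Closure.
Context d (T : measurableType d).
Implicit Types f g : T -> R.

Lemma bmeas_cst (a : R) : bmeas (fun _ : T => a).
Proof. by split; [exact: measurable_cst | exists `|a|]. Qed.

Lemma bmeasD f g : bmeas f -> bmeas g -> bmeas (fun x => f x + g x).
Proof.
move=> [mf [M fM]] [mg [N gN]]; split; first exact: measurable_funD.
by exists (M + N) => x; rewrite (le_trans (ler_normD _ _))// lerD.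
Qed.

Lemma bmeasM f g : bmeas f -> bmeas g -> bmeas (fun x => f x * g x).
Proof.
move=> [mf [M fM]] [mg [N gN]]; split; first exact: measurable_funM.
by exists (M * N) => x; rewrite normrM ler_pM.
Qed.

Lemma bmeasX f n : bmeas f -> bmeas (fun x => f x ^+ n).
Proof.
move=> bf; elim: n => [|n IHn]; first exact: bmeas_cst.
by under eq_fun do rewrite exprS; exact: bmeasM.
Qed.

Lemma bmeas_prod (I : Type) (s : seq I) (P : pred I) (F : I -> T -> R) :
  (forall i, bmeas (F i)) -> bmeas (fun x => \prod_(i <- s | P i) F i x).
Proof.
move=> bF; elim: s => [|i s IHs].
  by under eq_fun do rewrite big_nil; exact: bmeas_cst.
under eq_fun do rewrite big_cons.
by case: (P i) => //; exact: bmeasM.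
Qed.

Lemma bmeas_comp d' (T' : measurableType d') (f : T -> R) (h : T' -> T) :
  measurable_fun [set: T'] h -> bmeas f -> bmeas (fun x => f (h x)).
Proof.
move=> mh [mf [M fM]]; split; last by exists M => x; exact: fM.
exact: (measurableT_comp mf mh).
Qed.

End Closure.

Section Mean.
Context d (T : measurableType d) (mu : {measure set T -> \bar R}) (D : set T).
Hypotheses (mD : measurable D) (muD : mu D = 1%E).
Implicit Types f g h : T -> R.

Lemma bmeas_integrable f : bmeas f -> mu.-integrable D (EFin \o f).
Proof.
move=> [mf [M fM]]; apply: measurable_bounded_integrable => //.
- by rewrite muD ltry.
- exact: measurable_funTS.
- exists M; split; first exact: num_real.
  by move=> x Mx y _ /=; exact: le_trans (fM y) (ltW Mx).
Qed.

Lemma mean_cst (a : R) : \int[mu]_(x in D) a = a.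
Proof. by rewrite Rintegral_cst// muD mulr1. Qed.

Lemma meanD f g : bmeas f -> bmeas g ->
  \int[mu]_(x in D) (f x + g x) =
  \int[mu]_(x in D) f x + \int[mu]_(x in D) g x.
Proof. by move=> bf bg; rewrite RintegralD//; exact: bmeas_integrable. Qed.

Lemma meanZ (a : R) f : bmeas f ->
  \int[mu]_(x in D) (a * f x) = a * \int[mu]_(x in D) f x.
Proof. by move=> bf; rewrite RintegralZl//; exact: bmeas_integrable. Qed.

Lemma mean_sum (I : Type) (s : seq I) (P : pred I) (F : I -> T -> R) :
  (forall i, bmeas (F i)) ->
  \int[mu]_(x in D) (\sum_(i <- s | P i) F i x) =
  \sum_(i <- s | P i) \int[mu]_(x in D) F i x.
Proof.
move=> bF; elim: s => [|i s IHs].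
  by under eq_Rintegral do rewrite big_nil; rewrite big_nil mean_cst.
under eq_Rintegral do rewrite big_cons.
rewrite big_cons; case: (P i) => //.
rewrite meanD ?IHs//; move: IHs => _; elim: s => [|j s IHs].
  by under eq_fun do rewrite big_nil; exact: bmeas_cst.
under eq_fun do rewrite big_cons.
by case: (P j) => //; exact: bmeasD.
Qed.

Lemma mean_norm_le f M : bmeas f -> (forall x, `|f x| <= M) ->
  `|\int[mu]_(x in D) f x| <= M.
Proof.
move=> bf fM; apply: le_trans (le_normr_Rintegral mD _) _.
  exact: bmeas_integrable.
rewrite -[leRHS]mean_cst; apply: le_Rintegral => //.
- apply: (bmeas_integrable (f := fun x => `|f x|)); case: bf => mf [N fN].
  split; first by apply: measurableT_comp.
  by exists N => x; rewrite normr_id.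
- by apply: (bmeas_integrable (f := fun=> M)); exact: bmeas_cst.
Qed.

(** Cauchy-Schwarz in the degenerate case: the quadratic polynomial
    [s |-> \int (s * h + f)^2] is nonnegative and has leading coefficient zero, so
    its linear coefficient vanishes as well. *)
Lemma mean_sqr_eq0 h f : bmeas h -> bmeas f ->
  \int[mu]_(x in D) h x ^+ 2 = 0 -> \int[mu]_(x in D) (h x * f x) = 0.
Proof.
move=> bh bf h0.
set b := Rintegral _ _ _; set c := \int[mu]_(x in D) f x ^+ 2.
have quad s : 0 <= (2 * s) * b + c.
  have : 0 <= \int[mu]_(x in D) (s * h x + f x) ^+ 2.
    by apply: Rintegral_ge0 => x _; exact: sqr_ge0.
  have -> : (fun x => (s * h x + f x) ^+ 2) =
      (fun x => s ^+ 2 * h x ^+ 2 + (2 * s * (h x * f x) + f x ^+ 2)).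
    by apply/funext => x; ring.
  have bhf : bmeas (fun x => h x * f x) by exact: bmeasM.
  have bM (a : R) g : bmeas g -> bmeas (fun x => a * g x).
    by move=> bg; apply: bmeasM => //; exact: bmeas_cst.
  rewrite meanD ?meanD ?meanZ// ?h0 ?mulr0 ?add0r//;
    by [exact: bmeasX | apply: bM => //; exact: bmeasX
       | apply: bmeasD; [exact: bM|exact: bmeasX]].
have c0 : 0 <= c by have := quad 0; rewrite mulr0 mul0r add0r.
apply/eqP/negPn/negP => b0.
(* At this [s] the affine function [2 * s * b + c] takes the value [-1]. *)
have := quad (- (c + 1) / (2 * b)).
have -> : 2 * (- (c + 1) / (2 * b)) * b = - (c + 1).
  by field; rewrite b0.
by rewrite opprD addrAC addNr add0r oppr_ge0 ler10.
Qed.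

End Mean.

Section Fubini.
Context d1 d2 (X : measurableType d1) (Y : measurableType d2).
Context (mu : {sigma_finite_measure set X -> \bar R}).
Context (nu : {sigma_finite_measure set Y -> \bar R}).
Context (A : set X) (B : set Y) (f : X * Y -> R).
Hypotheses (mA : measurable A) (mB : measurable B).
Hypotheses (muA : mu A = 1%E) (nuB : nu B = 1%E).
Hypothesis bf : bmeas f.

Let g : X * Y -> \bar R := EFin \o (f \_ (A `*` B)).

Let prodAB : (mu \x nu)%E (A `*` B) = 1%E.
Proof.
transitivity (mu A * nu B)%E; first exact: product_measure1E.
by rewrite muA nuB mule1.
Qed.

Let ig : (mu \x nu)%E.-integrable setT g.
Proof.
rewrite /g -restrict_EFin -integrable_mkcond; last exact: measurableX.
by apply: bmeas_integrable => //; exact: measurableX.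
Qed.

Let bsec2 x : bmeas (fun y => f (x, y)).
Proof. by apply: bmeas_comp bf => //; exact: measurable_pair1. Qed.

Let bsec1 y : bmeas (fun x => f (x, y)).
Proof. by apply: bmeas_comp bf => //; exact: measurable_pair2. Qed.

Let gF x : (\int[nu]_y g (x, y))%E =
  ((fun x => (\int[nu]_(y in B) f (x, y))%:E) \_ A) x.
Proof.
rewrite patchE; case: ifPn => xA.
  rewrite /Rintegral fineK; last first.
    by apply: integrable_fin_num => //; exact: (bmeas_integrable mB nuB).
  rewrite [RHS]integral_mkcond; apply: eq_integral => y _.
  rewrite /g /= !patchE in_setX /= xA /=.
  by case: ifP.
rewrite (eq_integral (cst 0%E)) ?integral0// => y _.
by rewrite /g /= patchE in_setX /= (negbTE xA).
Qed.

Let gG y : (\int[mu]_x g (x, y))%E =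
  ((fun y => (\int[mu]_(x in A) f (x, y))%:E) \_ B) y.
Proof.
rewrite patchE; case: ifPn => yB.
  rewrite /Rintegral fineK; last first.
    by apply: integrable_fin_num => //; exact: (bmeas_integrable mA muA).
  rewrite [RHS]integral_mkcond; apply: eq_integral => x _.
  rewrite /g /= !patchE in_setX /= yB andbT /=.
  by case: ifP.
rewrite (eq_integral (cst 0%E)) ?integral0// => x _.
by rewrite /g /= patchE in_setX /= (negbTE yB) andbF.
Qed.

Lemma mean_prodE : \int[(mu \x nu)%E]_(z in A `*` B) f z =
  \int[mu]_(x in A) \int[nu]_(y in B) f (x, y).
Proof.
rewrite /Rintegral; congr fine; rewrite integral_mkcond restrict_EFin -/g.
rewrite -(integral12_prod_meas1 ig) [RHS]integral_mkcond.
by apply: eq_integral => x _; exact: gF.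
Qed.

Lemma mean_swap : \int[mu]_(x in A) \int[nu]_(y in B) f (x, y) =
  \int[nu]_(y in B) \int[mu]_(x in A) f (x, y).
Proof.
rewrite -mean_prodE /Rintegral; congr fine.
rewrite integral_mkcond restrict_EFin -/g.
rewrite -(integral21_prod_meas1 ig) [RHS]integral_mkcond.
by apply: eq_integral => y _; exact: gG.
Qed.

End Fubini.

Section ParametricMean.
Context d1 d2 (X : measurableType d1) (Y : measurableType d2).
Context (nu : {sigma_finite_measure set Y -> \bar R}) (B : set Y).
Context (f : X * Y -> R).
Hypotheses (mB : measurable B) (nuB : nu B = 1%E).

(** The constant [M] makes the integrand nonnegative, where Tonelli's theorem gives
    measurability in the parameter. *)
Lemma bmeas_mean : bmeas f ->
  bmeas (fun x => \int[nu]_(y in B) f (x, y)).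
Proof.
move=> bf; have bsec x : bmeas (fun y => f (x, y)).
  by apply: bmeas_comp bf => //; exact: measurable_pair1.
split; last first.
  by case: (bf) => _ [M fM]; exists M => x; apply: mean_norm_le.
have [M fM] := bf.2.
have -> : (fun x => \int[nu]_(y in B) f (x, y)) =
   (fun x => \int[nu]_(y in B) (f (x, y) + M) - M).
  apply/funext => x; rewrite meanD ?mean_cst ?addrK//; exact: bmeas_cst.
apply: measurable_funB; last exact: measurable_cst.
rewrite /Rintegral.
apply: measurableT_comp; first exact: fine_measurable.
have -> : (fun x => (\int[nu]_(y in B) (f (x, y) + M)%:E)%E) =
   fubini_F nu (EFin \o ((fun z => f z + M) \_ (setT `*` B))).
  apply/funext => x; rewrite /fubini_F [LHS]integral_mkcond; apply: eq_integral => y _.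
  by rewrite /= !patchE in_setX /= in_setT; case: ifP.
apply: measurable_fun_fubini_tonelli_F.
- apply/measurable_EFinP/measurable_restrict => //; first exact: measurableX.
  by apply: measurable_funTS; apply: measurable_funD => //; case: bf.
- move=> z; rewrite lee_fin patchE; case: ifP => // _.
  by have := fM z; rewrite ler_norml => /andP[]; rewrite -lerBlDr sub0r.
Qed.

End ParametricMean.
End BoundedMeasurable.

(** * Averages over the unit interval and the unit cube *)

Section Cube.
Local Open Scope classical_set_scope.
Local Open Scope ring_scope.
Context {R : realType}.
Local Notation leb := (@lebesgue_measure R).
Local Notation I01 := ([set` `[0, 1]] : set R).

Definition cube n : set (n.-tuple R) :=
  [set x | forall k, tnth x k \in `[0, 1]].
Local Arguments cube n : clear implicits.

Definition cube_mean n (f : n.-tuple R -> R) : R :=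
  \int[tuple_measure leb n]_(x in cube n) f x.

Definition upd n (x : n.-tuple R) (v : 'I_n) (y : R) : n.-tuple R :=
  [tuple if i == v then y else tnth x i | i < n].

Lemma tnth_upd n (x : n.-tuple R) v y i :
  tnth (upd x v y) i = if i == v then y else tnth x i.
Proof. exact: tnth_mktuple. Qed.

Lemma measurable_I01 : measurable I01.
Proof. exact: measurable_itv. Qed.

Lemma leb_I01 : leb I01 = 1%E.
Proof. by rewrite lebesgue_measure_itv /= lte_fin ltr01 -EFinB subr0. Qed.

Lemma measurable_cube n : measurable (cube n).
Proof. by apply: (@measurable_box _ _ n (fun=> I01)) => _; exact: measurable_I01. Qed.

Lemma measure_cube n : tuple_measure leb n (cube n) = 1%E.
Proof.
transitivity (\prod_(i < n) leb I01)%E.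
  by apply: (@tuple_measure_box _ _ _ leb n (fun=> I01)) => _; exact: measurable_I01.
by rewrite big1// => i _; exact: leb_I01.
Qed.

Local Hint Resolve measurable_I01 leb_I01 measurable_cube measure_cube : core.

Definition mean01 (f : R -> R) : R := \int[leb]_(y in I01) f y.

Lemma mean01_cst a : mean01 (fun=> a) = a.
Proof. exact: (mean_cst (mu := leb) measurable_I01 leb_I01). Qed.

Lemma mean01Z a f : bmeas f -> mean01 (fun y => a * f y) = a * mean01 f.
Proof. exact: (meanZ (mu := leb) measurable_I01 leb_I01). Qed.

Lemma mean01_ge0 f : (forall x, 0 <= f x) -> 0 <= mean01 f.
Proof. by move=> f0; apply: Rintegral_ge0. Qed.

Lemma mean01_sqr_eq0 h f : bmeas h -> bmeas f ->
  mean01 (fun y => h y ^+ 2) = 0 -> mean01 (fun y => h y * f y) = 0.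
Proof. exact: (mean_sqr_eq0 (mu := leb) measurable_I01 leb_I01). Qed.

Lemma bmeas_mean01 d (X : measurableType d) (f : X * R -> R) : bmeas f ->
  bmeas (fun x => mean01 (fun y => f (x, y))).
Proof. exact: (bmeas_mean (nu := leb) measurable_I01 leb_I01). Qed.

Lemma mean01_swap (f : R * R -> R) : bmeas f ->
  mean01 (fun x => mean01 (fun y => f (x, y))) =
  mean01 (fun y => mean01 (fun x => f (x, y))).
Proof.
exact: (mean_swap (mu := leb) (nu := leb) measurable_I01 measurable_I01
  leb_I01 leb_I01).
Qed.

Lemma measurable_upd n (v : 'I_n) :
  measurable_fun [set: n.-tuple R * R] (fun z => upd z.1 v z.2).
Proof.
apply/measurable_fun_tnthP => i.
have -> : (@tnth n R)^~ i \o (fun z : n.-tuple R * R => upd z.1 v z.2) =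
    fun z => if i == v then z.2 else tnth z.1 i.
  by apply/funext => z /=; rewrite tnth_upd.
case: eqP => _; first exact: measurable_snd.
apply: (measurableT_comp (f := fun x : n.-tuple R => tnth x i)).
  exact: measurable_tnth.
exact: measurable_fst.
Qed.

Lemma measurable_updr n (v : 'I_n) x :
  measurable_fun [set: R] (fun y => upd x v y).
Proof.
apply: (measurableT_comp (measurable_upd v) (g := fun y => (x, y))).
exact: measurable_pair1.
Qed.

(** The measure on the cube is the image of a product measure under [tcons]. *)
Lemma cube_meanS n (f : n.+1.-tuple R -> R) : bmeas f ->
  cube_mean f =
  mean01 (fun a => cube_mean (fun x => f (tcons (a, x)))).
Proof.
move=> bf; have mc := @measurable_tcons _ R n.
have bfc : bmeas (fun z : R * n.-tuple R => f (tcons z)) by exact: bmeas_comp bf.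
transitivity (\int[(leb \x tuple_measure leb n)%E]_(z in I01 `*` cube n)
    f (tcons z)); last first.
  exact: (mean_prodE (mu := leb) (nu := tuple_measure leb n)
    measurable_I01 (@measurable_cube n) leb_I01 (measure_cube n) bfc).
rewrite /cube_mean /Rintegral; congr fine.
have cubeS : @tcons _ R n @^-1` cube n.+1 = I01 `*` cube n.
  exact: (@tcons_box _ R n (fun=> I01)).
have mprod : measurable (I01 `*` cube n) by exact: measurableX.
have prod1 : (leb \x tuple_measure leb n)%E (I01 `*` cube n) = 1%E.
  transitivity (leb I01 * tuple_measure leb n (cube n))%E.
    exact: (product_measure1E leb (tuple_measure leb n)
      measurable_I01 (@measurable_cube n)).
  by rewrite leb_I01 measure_cube mule1.
rewrite -cubeS; apply: integral_pushforward.
- exact: mc.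
- by apply/measurable_EFinP; case: bf.
- rewrite cubeS; exact: (bmeas_integrable
    (mu := (leb \x tuple_measure leb n)%E) mprod prod1 bfc).
- exact: measurable_cube.
Qed.

Lemma upd_tcons0 n (a y : R) (x : n.-tuple R) :
  upd (tcons (a, x)) ord0 y = tcons (y, x).
Proof.
apply: eq_from_tnth => i; rewrite tnth_upd.
by case: (unliftP ord0 i) => [j ->|->] /=; rewrite ?tnthS ?tnth0.
Qed.

Lemma upd_tconsS n (a y : R) (x : n.-tuple R) j :
  upd (tcons (a, x)) (lift ord0 j) y = tcons (a, upd x j y).
Proof.
apply: eq_from_tnth => i; rewrite tnth_upd.
case: (unliftP ord0 i) => [k ->|->] /=; rewrite ?tnthS ?tnth0//.
by rewrite tnth_upd (inj_eq lift_inj).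
Qed.

Lemma bmeas_upd n (v : 'I_n) (f : n.-tuple R -> R) : bmeas f ->
  bmeas (fun x => mean01 (fun y => f (upd x v y))).
Proof.
move=> bf; apply: (bmeas_mean01 (f := fun z => f (upd z.1 v z.2))).
by apply: bmeas_comp bf; exact: measurable_upd.
Qed.

(** Fubini's theorem in the form used throughout: a coordinate may be averaged out
    first, without ordering the coordinates. *)
Lemma cube_mean_upd n (v : 'I_n) (f : n.-tuple R -> R) : bmeas f ->
  cube_mean (fun x => mean01 (fun y => f (upd x v y))) = cube_mean f.
Proof.
elim: n v f => [[]//|n IHn] v f bf; have mc := @measurable_tcons _ R n.
rewrite !cube_meanS//; last exact: bmeas_upd.
have bfc : bmeas (fun z : R * n.-tuple R => f (tcons z)) by exact: bmeas_comp bf.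
case: (unliftP ord0 v) => [j ->|->].
  apply: eq_Rintegral => a _; rewrite -[RHS](IHn j); last first.
    by apply: (bmeas_comp (h := fun x => (a, x))) bfc; exact: measurable_pair1.
  by congr cube_mean; apply/funext => x; apply: eq_Rintegral => y _; rewrite upd_tconsS.
have -> : (fun a => cube_mean (fun x => mean01 (fun y => f (upd (tcons (a, x)) ord0 y))))
  = (fun a => cube_mean (fun x => mean01 (fun y => f (tcons (y, x))))).
  apply/funext => a; congr cube_mean; apply/funext => x.
  by apply: eq_Rintegral => y _; rewrite upd_tcons0.
rewrite mean01_cst /cube_mean.
exact/esym/(mean_swap (mu := leb) (nu := tuple_measure leb n)
  measurable_I01 (@measurable_cube n) leb_I01
  (measure_cube n) bfc).
Qed.

Lemma cube_mean_cst n a : cube_mean (fun _ : n.-tuple R => a) = a.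
Proof. exact: (mean_cst (mu := tuple_measure leb n)
  (@measurable_cube n) (measure_cube n)). Qed.

Lemma cube_meanZ n a (f : n.-tuple R -> R) : bmeas f ->
  cube_mean (fun x => a * f x) = a * cube_mean f.
Proof. exact: (meanZ (mu := tuple_measure leb n)
  (@measurable_cube n) (measure_cube n)). Qed.

Lemma cube_mean_sum n (I : Type) (s : seq I) (P : pred I)
    (F : I -> n.-tuple R -> R) : (forall i, bmeas (F i)) ->
  cube_mean (fun x => \sum_(i <- s | P i) F i x) =
  \sum_(i <- s | P i) cube_mean (F i).
Proof. exact: (mean_sum (mu := tuple_measure leb n)
  (@measurable_cube n) (measure_cube n)). Qed.

Lemma cube_mean_ge0 n (f : n.-tuple R -> R) : (forall x, 0 <= f x) ->
  0 <= cube_mean f.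
Proof. by move=> f0; apply: Rintegral_ge0. Qed.

Lemma cube_mean_sqr_eq0 n (h f : n.-tuple R -> R) : bmeas h -> bmeas f ->
  cube_mean (fun x => h x ^+ 2) = 0 -> cube_mean (fun x => h x * f x) = 0.
Proof. exact: (mean_sqr_eq0 (mu := tuple_measure leb n)
  (@measurable_cube n) (measure_cube n)). Qed.

End Cube.

(** * Kernels, their integral operators, and densities of edge sets *)

Section Kernel.
Context {R : realType} (K : R * R -> R).
Hypotheses (bK : bmeas K) (Ksym : forall y z, K (y, z) = K (z, y)).

(** [kernel_pow m] is the kernel of the [m.+1]-th power of [kernel_op]: the weight of
    walks with [m] interior vertices. *)
Fixpoint kernel_pow m : R * R -> R :=
  if m is m'.+1 then fun p => mean01 (fun z => K (p.1, z) * kernel_pow m' (z, p.2))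
  else K.

Definition kernel_op (f : R -> R) (y : R) : R := mean01 (fun z => K (y, z) * f z).

Lemma bmeas_pair d (T : measurableType d) (f g : T -> R) (h : R * R -> R) :
  measurable_fun [set: T] f -> measurable_fun [set: T] g -> bmeas h ->
  bmeas (fun t => h (f t, g t)).
Proof.
move=> mf mg bh; apply: (bmeas_comp (h := fun t => (f t, g t))) bh.
exact: measurable_fun_pair.
Qed.

Lemma bmeas_sec1 (h : R * R -> R) y : bmeas h -> bmeas (fun z => h (y, z)).
Proof. by apply: bmeas_pair => //; exact: measurable_cst. Qed.

Lemma bmeas_sec2 (h : R * R -> R) z : bmeas h -> bmeas (fun y => h (y, z)).
Proof. by apply: bmeas_pair => //; exact: measurable_cst. Qed.

Lemma bmeas_fst (f : R -> R) : bmeas f -> bmeas (fun p : R * R => f p.1).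
Proof. by apply: bmeas_comp; exact: measurable_fst. Qed.

Lemma bmeas_snd (f : R -> R) : bmeas f -> bmeas (fun p : R * R => f p.2).
Proof. by apply: bmeas_comp; exact: measurable_snd. Qed.

Lemma bmeas_kernel_pow m : bmeas (kernel_pow m).
Proof.
elim: m => [//|m IHm] /=.
apply: (bmeas_mean01 (f := fun t : R * R * R => K (t.1.1, t.2) * kernel_pow m (t.2, t.1.2))).
apply: bmeasM; apply: bmeas_pair => //.
- by apply: measurableT_comp.
- by apply: measurableT_comp.
Qed.

Lemma bmeas_kernel_op f : bmeas f -> bmeas (kernel_op f).
Proof.
move=> bf; apply: (bmeas_mean01 (f := fun p => K p * f p.2)).
by apply: bmeasM => //; exact: bmeas_snd.
Qed.

Lemma bmeas_iter_kernel_op m f : bmeas f -> bmeas (iter m kernel_op f).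
Proof. by move=> bf; elim: m => [//|m IHm] /=; exact: bmeas_kernel_op. Qed.

Lemma iter_kernel_opE m f y : bmeas f ->
  iter m.+1 kernel_op f y = mean01 (fun z => kernel_pow m (y, z) * f z).
Proof.
move=> bf; elim: m y => [//|m IHm] y.
rewrite iterS /kernel_op; under eq_fun do rewrite IHm.
have bk z : bmeas (fun w => kernel_pow m (z, w) * f w).
  by apply: bmeasM => //; apply: bmeas_sec1; exact: bmeas_kernel_pow.
under eq_fun do rewrite -mean01Z//.
rewrite (mean01_swap (f := fun p => K (y, p.1) * (kernel_pow m p * f p.2))); last first.
  apply: bmeasM; first exact: (bmeas_fst (bmeas_sec1 y bK)).
  by apply: bmeasM; [exact: bmeas_kernel_pow|exact: bmeas_snd].
congr mean01; apply/funext => z /=; rewrite mulrC -mean01Z.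
  by congr mean01; apply/funext => w; ring.
by apply: bmeasM; [exact: bmeas_sec1|apply: bmeas_sec2; exact: bmeas_kernel_pow].
Qed.

Lemma kernel_op_sym f g : bmeas f -> bmeas g ->
  mean01 (fun y => kernel_op f y * g y) = mean01 (fun y => f y * kernel_op g y).
Proof.
move=> bf bg; rewrite /kernel_op.
have bKf (h : R -> R) y : bmeas h -> bmeas (fun z => K (y, z) * h z).
  by move=> bh; apply: bmeasM => //; exact: bmeas_sec1.
have -> : (fun y => mean01 (fun z => K (y, z) * f z) * g y) =
    (fun y => mean01 (fun z => g y * (K (y, z) * f z))).
  by apply/funext => y; rewrite mulrC mean01Z//; exact: bKf.
rewrite (mean01_swap (f := fun p => g p.1 * (K p * f p.2))); last first.
  by apply: bmeasM; [exact: bmeas_fst|apply: bmeasM => //; exact: bmeas_snd].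
congr mean01; apply/funext => z /=; rewrite -mean01Z; last exact: bKf.
by congr mean01; apply/funext => y; rewrite Ksym; ring.
Qed.

(** A self-adjoint operator [T] with a vanishing power vanishes: the squared norm
    of [T^(m+1) f] is the pairing of [T^m f] with [T^(m+2) f]. *)
Lemma kernel_op_eq0 m :
  (forall f g, bmeas f -> bmeas g ->
     mean01 (fun y => iter m.+1 kernel_op f y * g y) = 0) ->
  forall f g, bmeas f -> bmeas g -> mean01 (fun y => kernel_op f y * g y) = 0.
Proof.
elim: m => [//|m IHm] K0; apply: IHm => f g bf bg.
apply: mean01_sqr_eq0 => //; first exact: bmeas_iter_kernel_op.
under eq_fun do rewrite expr2.
rewrite [LHS]kernel_op_sym; [|exact: bmeas_iter_kernel_op|exact: bmeas_iter_kernel_op].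
under eq_fun do rewrite mulrC.
by apply: K0 => //; exact: bmeas_iter_kernel_op.
Qed.

Section Vertices.
Context (V : finType).
Implicit Types (a b u v : V) (x : #|V|.-tuple R) (f r : #|V|.-tuple R -> R).

Definition vcoord x v : R := tnth x (enum_rank v).
Definition vupd x v (y : R) := upd x (enum_rank v) y.
(** Encodes that [f] does not depend on the coordinate of [v]. *)
Definition indep v f := forall x y, f (vupd x v y) = f x.

Lemma vcoord_vupd x v y u : vcoord (vupd x v y) u = if u == v then y else vcoord x u.
Proof. by rewrite /vcoord tnth_upd (inj_eq enum_rank_inj). Qed.

Lemma vcoord_vupd_id x v y : vcoord (vupd x v y) v = y.
Proof. by rewrite vcoord_vupd eqxx. Qed.

Lemma vcoord_vupd_neq x v y u : u != v -> vcoord (vupd x v y) u = vcoord x u.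
Proof. by rewrite vcoord_vupd => /negbTE ->. Qed.

Lemma vupdC x u v y z : u != v -> vupd (vupd x u y) v z = vupd (vupd x v z) u y.
Proof.
move=> uv; apply: eq_from_tnth => i.
rewrite -[i]enum_valK -!/(vcoord _ _) !vcoord_vupd.
by case: eqP => // ->; rewrite eq_sym (negbTE uv).
Qed.

Lemma measurable_vcoord v : measurable_fun [set: #|V|.-tuple R] (fun x => vcoord x v).
Proof. exact: measurable_tnth. Qed.

Lemma bmeas_vcoord v (h : R -> R) : bmeas h -> bmeas (fun x => h (vcoord x v)).
Proof. by apply: bmeas_comp; exact: measurable_vcoord. Qed.

Lemma bmeas_vcoord2 u v (h : R * R -> R) : bmeas h ->
  bmeas (fun x => h (vcoord x u, vcoord x v)).
Proof. by apply: bmeas_pair; exact: measurable_vcoord. Qed.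

Lemma bmeas_vupd x v f : bmeas f -> bmeas (fun y => f (vupd x v y)).
Proof. by apply: bmeas_comp; exact: measurable_updr. Qed.

(** The form in which a vertex is integrated out: [g] is the conditional average of
    [f] given all other vertices. *)
Lemma cube_mean_cond v f g : bmeas f ->
  (forall x, mean01 (fun y => f (vupd x v y)) = g x) -> cube_mean f = cube_mean g.
Proof.
move=> bf fg; rewrite -(cube_mean_upd (enum_rank v) bf).
by congr cube_mean; apply/funext => x; rewrite -fg.
Qed.

Lemma cube_mean_vcoord v (h : R -> R) : bmeas h ->
  cube_mean (fun x => h (vcoord x v)) = mean01 h.
Proof.
move=> bh; rewrite -[RHS](cube_mean_cst #|V|).
apply: (cube_mean_cond (v := v)); first exact: bmeas_vcoord.
by move=> x; congr mean01; apply/funext => y; rewrite vcoord_vupd_id.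
Qed.

Lemma cube_mean_vcoord2 u v (h : R * R -> R) : u != v -> bmeas h ->
  cube_mean (fun x => h (vcoord x u, vcoord x v)) =
  mean01 (fun y => mean01 (fun z => h (y, z))).
Proof.
move=> uv bh; rewrite -(cube_mean_vcoord u); last exact: bmeas_mean01.
apply: (cube_mean_cond (v := v)); first exact: bmeas_vcoord2.
move=> x; congr mean01; apply/funext => y.
by rewrite vcoord_vupd_id vcoord_vupd_neq.
Qed.

Fixpoint walk_weight a (p : seq V) x : R :=
  if p is b :: p' then K (vcoord x a, vcoord x b) * walk_weight b p' x else 1.

Lemma bmeas_walk_weight a p : bmeas (walk_weight a p).
Proof.
elim: p a => [|b p IHp] a /=; first exact: bmeas_cst.
by apply: bmeasM => //; exact: bmeas_vcoord2.
Qed.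

(** Integrating out the interior vertices of a walk composes its kernels; the
    end points may coincide, so this also evaluates a cycle from one vertex. *)
Lemma cube_mean_walk a b s r : bmeas r -> uniq s -> a \notin s -> b \notin s ->
  {in s, forall v, indep v r} ->
  cube_mean (fun x => walk_weight a (rcons s b) x * r x) =
  cube_mean (fun x => kernel_pow (size s) (vcoord x a, vcoord x b) * r x).
Proof.
elim: s a r => [|v s IHs] a r br /= us as_ bs rs.
  by congr cube_mean; apply/funext => x; rewrite mulr1.
move: us as_ bs; rewrite !inE !negb_or => /andP[vs us] /andP[av as_] /andP[bv bs].
have bKa : bmeas (fun x => K (vcoord x a, vcoord x v) * r x).
  by apply: bmeasM => //; exact: bmeas_vcoord2.
have := IHs v _ bKa us vs bs.
have -> : (fun x => walk_weight v (rcons s b) x * (K (vcoord x a, vcoord x v) * r x)) =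
   (fun x => K (vcoord x a, vcoord x v) * walk_weight v (rcons s b) x * r x).
  by apply/funext => x; ring.
move=> -> => [|w ws x y]; last first.
  rewrite (rs w) ?inE ?ws ?orbT// !vcoord_vupd_neq//.
    by apply: contraNneq vs => ->.
  by apply: contraNneq as_ => ->.
apply: (cube_mean_cond (v := v)).
  by apply: bmeasM => //; apply: bmeas_vcoord2; exact: bmeas_kernel_pow.
move=> x; rewrite mulrC -mean01Z; last first.
  by apply: bmeasM; [exact: bmeas_sec1|apply: bmeas_sec2; exact: bmeas_kernel_pow].
congr mean01; apply/funext => y; rewrite vcoord_vupd_id !vcoord_vupd_neq//.
by rewrite (rs v) ?mem_head//=; ring.
Qed.

Definition edges_weight (S : {set V * V}) x : R :=
  \prod_(p in S) K (vcoord x p.1, vcoord x p.2).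

Lemma bmeas_edges_weight S : bmeas (edges_weight S).
Proof. by apply: bmeas_prod => p; exact: bmeas_vcoord2. Qed.

Definition touches (p : V * V) v := (v == p.1) || (v == p.2).

Lemma indep_edges_weight v (S : {set V * V}) :
  {in S, forall p, ~~ touches p v} -> indep v (edges_weight S).
Proof.
move=> Sv x y; apply: eq_bigr => p /Sv; rewrite negb_or => /andP[v1 v2].
by rewrite !vcoord_vupd_neq// eq_sym.
Qed.

(** With the other vertices fixed, the weight of [S] is [K (x_u, x_v)] times a function
    of [x_u] times a function of [x_v]: averaging over the two ends [u], [v] of the
    edge [p] is a pairing [<f, T g>]. The hypothesis on [q] says that [p] is the only
    edge of [S] joining its ends. *)
Lemma cube_mean_edges_weight_eq0 (S : {set V * V}) p : p \in S -> p.1 != p.2 ->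
  (forall q, q \in S -> touches q p.1 -> touches q p.2 -> q = p) ->
  (forall f g : R -> R, bmeas f -> bmeas g ->
     mean01 (fun y => kernel_op f y * g y) = 0) ->
  cube_mean (edges_weight S) = 0.
Proof.
case: p => u v /= Sp uv Suv K0.
pose S1 := [set q in S :\ (u, v) | ~~ touches q v].
pose S2 := [set q in S :\ (u, v) | touches q v].
have E x : edges_weight S x =
    K (vcoord x u, vcoord x v) * edges_weight S1 x * edges_weight S2 x.
  rewrite /edges_weight (big_setD1 _ Sp) /= -mulrA; congr (_ * _).
  rewrite (bigID (fun q => touches q v)) /= mulrC; congr (_ * _);
    by apply: eq_bigl => q; rewrite !inE.
have i1 : indep v (edges_weight S1).
  by apply: indep_edges_weight => q; rewrite !inE => /andP[].
have i2 : indep u (edges_weight S2).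
  apply: indep_edges_weight => q; rewrite !inE => /andP[/andP[q1 qS] qv].
  by apply: contra q1 => qu; apply/eqP; exact: Suv.
have bS := bmeas_edges_weight.
pose g x := mean01 (fun z => edges_weight S (vupd x v z)).
have bg : bmeas g by apply: bmeas_upd; exact: bS.
rewrite (cube_mean_cond (v := v) (g := g))//.
rewrite -[RHS](cube_mean_cst #|V|); apply: (cube_mean_cond (v := u)) => // x.
rewrite -(K0 (fun z => edges_weight S2 (vupd x v z)) (fun y => edges_weight S1 (vupd x u y)));
  try by apply: bmeas_vupd.
congr mean01; apply/funext => y; rewrite mulrC -mean01Z; last first.
  by apply: bmeasM; [exact: bmeas_sec1|exact: bmeas_vupd].
congr mean01; apply/funext => z; rewrite E i1 vcoord_vupd_id vcoord_vupd_neq//.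
rewrite vcoord_vupd_id [vupd (vupd _ _ _) _ _]vupdC// i2; ring.
Qed.

(** The hypothesis says that [T^(m+1)] has an almost everywhere vanishing kernel; it
    holds when a cycle of length [2 * (m + 1)] has density zero. *)
Lemma kernel_pow_sqr_eq0 m u v : u != v ->
  cube_mean (fun x => kernel_pow m (vcoord x u, vcoord x v) ^+ 2) = 0 ->
  forall f g : R -> R, bmeas f -> bmeas g ->
    mean01 (fun y => kernel_op f y * g y) = 0.
Proof.
move=> uv k0; apply: (@kernel_op_eq0 m) => f g bf bg.
have bk := bmeas_kernel_pow m.
have := cube_mean_sqr_eq0 (bmeas_vcoord2 u v bk)
  (bmeasM (bmeas_vcoord v bf) (bmeas_vcoord u bg)) k0.
rewrite (cube_mean_vcoord2 (h := fun p => kernel_pow m p * (f p.2 * g p.1)))//; last first.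
  by apply: bmeasM => //; apply: bmeasM; [exact: bmeas_snd|exact: bmeas_fst].
move=> <-; congr mean01; apply/funext => y.
rewrite iter_kernel_opE//= mulrC -mean01Z; last by apply: bmeasM => //; exact: bmeas_sec1.
by congr mean01; apply/funext => z; ring.
Qed.

Definition kernel_degree (y : R) : R := mean01 (fun z => K (y, z)).

Lemma bmeas_kernel_degree : bmeas kernel_degree.
Proof. exact: bmeas_mean01. Qed.

Lemma cube_mean_leaf u v r : u != v -> bmeas r -> indep v r ->
  cube_mean (fun x => K (vcoord x u, vcoord x v) * r x) =
  cube_mean (fun x => kernel_degree (vcoord x u) * r x).
Proof.
move=> uv br ri; apply: (cube_mean_cond (v := v)).
  by apply: bmeasM => //; exact: bmeas_vcoord2.
move=> x; rewrite mulrC -mean01Z; last exact: bmeas_sec1.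
by congr mean01; apply/funext => y; rewrite ri vcoord_vupd_id vcoord_vupd_neq// mulrC.
Qed.

End Vertices.
End Kernel.

(** * Two cycles in a graph of minimum degree two *)

Section Cycles.
Local Open Scope nat_scope.
Context (V : finType).
Implicit Types (a b u v w x y : V) (c p q s : seq V).

Definition ncommon c c' : nat := #|[set v in c] :&: [set v in c']|.

Section Relation.
Context (e : rel V).
Hypotheses (esym : symmetric e) (eirr : irreflexive e).

Definition simple_cycle c := (2 < size c) && ucycleb e c.

Lemma simple_cycle_rot n c : simple_cycle (rot n c) = simple_cycle c.
Proof. by rewrite /simple_cycle /ucycleb size_rot rot_cycle rot_uniq. Qed.

Lemma path_rev a q b : path e a (rcons q b) -> path e b (rcons (rev q) a).
Proof.
move=> pq; have : path (fun x y => e y x) a (rcons q b).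
  by rewrite (eq_path (e' := e)) // => x y; rewrite esym.
by rewrite -rev_path last_rcons belast_rcons rev_cons.
Qed.

(** The two arcs of an odd cycle between [a] and [b] have different parities,
    so one of them closes the ear [q] to an even cycle. *)
Lemma ear_even_cycle c a b q : simple_cycle c -> odd (size c) ->
  a \in c -> b \in c -> a != b ->
  path e a (rcons q b) -> uniq q -> {in q, forall v, v \notin c} ->
  [|| q != [::] | (next c a != b) && (next c b != a)] ->
  exists2 c', simple_cycle c' & ~~ odd (size c').
Proof.
move=> cc oc ac bc ab pq uq qc nt.
case: (rot_to ac) => i p Ec.
rewrite -(simple_cycle_rot i) Ec in cc.
rewrite -(size_rot i) Ec in oc.
rewrite -(mem_rot i) Ec in_cons eq_sym (negbTE ab) /= in bc.
have {}qc v : v \in q -> v \notin a :: p by move/qc; rewrite -(mem_rot i) Ec.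
have uc : uniq c by move: cc; rewrite -Ec simple_cycle_rot => /and3P[].
rewrite -!(next_rot i uc) Ec in nt.
case/splitPr: bc Ec cc oc qc nt => s1 s2 Ec /and3P[sc cyc ucs] oc qc nt.
have dq (s : seq V) : {subset s <= a :: s1 ++ b :: s2} -> ~~ has (mem q) s.
  by move=> ss; apply/hasPn => v /ss; apply: contraL => /qc.
move: cyc; rewrite /= rcons_cat cat_path /= => /and3P[p1 e1 p2].
move: (ucs); rewrite /= cat_uniq /= mem_cat in_cons !negb_or.
move=> /and5P[/and3P[a1 _ a2] u1 /andP[b1 h12] b2 u2].
have pr := path_rev pq.
have qa : a \notin q by apply/negP => /qc; rewrite mem_head.
have qb : b \notin q by apply/negP => /qc; rewrite inE mem_cat inE eqxx !orbT.
have C1 : ucycleb e (a :: s1 ++ b :: rev q).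
  rewrite /ucycleb /= rcons_cat cat_path /= p1 e1 pr /=.
  rewrite mem_cat in_cons mem_rev !negb_or a1 ab qa /=.
  rewrite cat_uniq u1 /= negb_or b1 mem_rev qb rev_uniq uq /= andbT.
  apply/hasPn => v; rewrite mem_rev => /qc; rewrite !inE mem_cat !negb_or.
  by case/and3P.
have C2 : ucycleb e (a :: q ++ b :: s2).
  rewrite /ucycleb /= rcons_cat /= -cat_rcons cat_path pq last_rcons p2 /=.
  rewrite mem_cat in_cons !negb_or qa ab a2 /=.
  rewrite cat_uniq uq /= negb_or qb b2 u2 /= andbT.
  by apply: dq => v v2; rewrite inE mem_cat inE v2 !orbT.
have s1n : q = [::] -> s1 <> [::].
  by move=> q0 s10; move: nt; rewrite q0 s10 /= !eqxx.
have s2n : q = [::] -> s2 <> [::].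
  move=> q0 s20; move: nt; rewrite q0 s20 eqxx orFb => /andP[_].
  rewrite (next_nth (a :: s1 ++ [:: b]) b) inE mem_cat inE eqxx !orbT /=.
  rewrite (negbTE ab) index_cat (negbTE b1) /= eqxx addn0.
  by rewrite nth_default ?eqxx// size_cat /= addn1.
have s3 (s r : seq V) : (r = [::] -> s <> [::]) -> 2 < size s + (size r).+2.
  by case: r => [|? ?]; case: s => [|? ?] H; rewrite /= ?addnS//; case: H.
have [par|par] := boolP (odd (size (a :: s1 ++ b :: rev q))); last first.
  exists (a :: s1 ++ b :: rev q) => //; rewrite /simple_cycle C1 andbT.
  by have := s3 _ _ s1n; rewrite /= size_cat /= size_rev addnS addnS.
exists (a :: q ++ b :: s2).
  rewrite /simple_cycle C2 andbT.
  by have := s3 _ _ s2n; rewrite /= size_cat /= !addnS addnC.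
move: oc par; rewrite /= !size_cat /= size_rev; clear; lia.
Qed.

Hypothesis noleaf : forall u v, e u v -> exists2 w, w != v & e u w.

(** The even cycle of the first alternative need not be related to [c]. *)
Definition second_cycle c : Prop :=
  (exists2 c', simple_cycle c' & ~~ odd (size c')) \/
  (exists c', [/\ simple_cycle c', odd (size c') & ncommon c c' <= 1]).

Lemma second_cycleI c c' : simple_cycle c' -> ncommon c c' <= 1 ->
  second_cycle c.
Proof.
move=> cc' n; case: (boolP (odd (size c'))) => o.
  by right; exists c'.
by left; exists c'.
Qed.

Lemma ncommon_disjoint c c' : {in c', forall v, v \notin c} -> ncommon c c' = 0.
Proof.
move=> cc'; apply/eqP; rewrite cards_eq0; apply/eqP/setP => v; rewrite !inE.
by apply/andP => -[vc /cc']; rewrite vc.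
Qed.

Section Ears.
Context (c : seq V).
Hypothesis ear : forall a b q, a \in c -> b \in c -> a != b -> q != [::] ->
  path e a (rcons q b) -> uniq q -> {in q, forall v, v \notin c} ->
  exists2 c', simple_cycle c' & ~~ odd (size c').

(** The end [x] of a maximal path has a neighbour other than its successor on the
    path. If that neighbour lies on the path, the path closes to a cycle disjoint
    from [c]. *)
Lemma end_of_maximal_path x p : p != [::] -> path e x p -> uniq (x :: p) ->
  {in x :: p, forall v, v \notin c} ->
  (forall w, e x w -> (w \in c) || (w \in x :: p)) ->
  second_cycle c \/ exists2 w, w \in c & e x w.
Proof.
case: p => // h p _ /= /andP[exh ph] /and3P[xhp hp up] disj maxi.
have [w wh xw] := noleaf exh.
have := maxi w xw; case: (boolP (w \in c)) => [wc _|_ /=]; first by right; exists w.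
rewrite !inE (negbTE wh); case: eqP => [wx|_ /=].
  by move: xw; rewrite wx eirr.
move=> wp; left; case/splitPr: wp ph xhp hp up disj {maxi} => s1 s2.
rewrite cat_path /= => /and3P[ph1 ew _].
rewrite !inE !mem_cat !inE !negb_or => /and4P[xh x1 xw' _] /and3P[h1 hw _].
rewrite cat_uniq /= negb_or => /and4P[u1 /andP[w1 _] _ _] disj.
apply: (@second_cycleI _ (x :: h :: rcons s1 w)).
  rewrite /simple_cycle /= size_rcons /ucycleb /= exh !rcons_path ph1 last_rcons ew esym xw /=.
  by rewrite !inE !mem_rcons !inE !negb_or xh x1 xw' h1 hw rcons_uniq w1 u1.
rewrite ncommon_disjoint// => v; rewrite !inE mem_rcons inE => H; apply: disj.
by rewrite !inE mem_cat inE; case/or4P: H => ->; rewrite ?orbT.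
Qed.

Lemma second_cycle_maximal_path x p : (exists v, e x v) ->
  path e x p -> uniq (x :: p) -> {in x :: p, forall v, v \notin c} ->
  (forall w, e x w -> (w \in c) || (w \in x :: p)) ->
  (forall w, e (last x p) w -> (w \in c) || (w \in x :: p)) ->
  second_cycle c.
Proof.
move=> [v xv] px up disj max1 max2.
have theta a b : a \in c -> b \in c -> a != b -> e x a -> e (last x p) b ->
    second_cycle c.
  move=> ac bc ab xa yb; left; apply: (ear (q := x :: p) ac bc ab) => //.
  by rewrite /= esym xa rcons_path px yb.
case: (eqVneq p [::]) => [p0|p0].
  have inc w : e x w -> w \in c.
    move=> xw; have := max1 w xw; rewrite p0 inE; case: eqP => [wx|]; last by rewrite orbF.
    by move: xw; rewrite wx eirr.
  have [w wv xw] := noleaf xv.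
  by apply: (theta v w); rewrite ?inc// 1?eq_sym// p0.
have [//|[w wc xw]] := end_of_maximal_path p0 px up disj max1.
have Er : last x p :: rev (belast x p) = rev (x :: p).
  by rewrite (lastI x p) rev_rcons.
have [|||||//|[w' w'c yw']] := @end_of_maximal_path (last x p) (rev (belast x p)).
- by rewrite -size_eq0 size_rev size_belast size_eq0.
- by rewrite rev_path (eq_path (e' := e)) // => y z; rewrite esym.
- by rewrite Er rev_uniq.
- by move=> y; rewrite Er mem_rev; exact: disj.
- by move=> y /max2; rewrite Er mem_rev.
have [ww'|ww'] := eqVneq w w'; last exact: (theta w w').
have wxp : w \notin x :: p by apply/negP => /disj; rewrite wc.
apply: (@second_cycleI _ (w :: x :: p)).
  rewrite /simple_cycle /ucycleb /= rcons_path px esym xw ww' yw' /= -ww'.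
  by move: up wxp => /= -> ->; case: (p) p0.
rewrite /ncommon -(cards1 w); apply: subset_leq_card; apply/fintype.subsetP => y.
rewrite !inE => /andP[yc /orP[//|yxp]].
by move: (disj y yxp); rewrite yc.
Qed.

(** A path outside [c] that cannot be prolonged returns at both ends to itself
    or to [c]: this yields a cycle disjoint from [c], a cycle through one vertex
    of [c], or an ear of [c]. *)
Lemma second_cycle_outside u v : u \notin c -> e u v -> second_cycle c.
Proof.
suff ext n x p : #|V| <= n + size (x :: p) -> (exists v, e x v) ->
    path e x p -> uniq (x :: p) -> {in x :: p, forall v, v \notin c} ->
    second_cycle c.
  move=> uc uv; apply: (ext #|V| u [::]) => //; first by rewrite leq_addr.
    by exists v.
  by move=> w; rewrite inE => /eqP->.
elim: n x p => [|n IHn] x p nV ex px up disj.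
  have full w : w \in x :: p.
    apply/negPn/negP => wp; have /card_uniqP sz : uniq (w :: x :: p) by rewrite /= wp.
    by have := max_card (mem (w :: x :: p)); rewrite sz leqNgt ltnS nV.
  by apply: (second_cycle_maximal_path ex px up disj) => w _; rewrite full orbT.
have [/existsP[w /and3P[xw wc wp]]|no1] :=
    boolP [exists w, [&& e x w, w \notin c & w \notin x :: p]].
  apply: (IHn w (x :: p)).
  - by rewrite /= addnS -addSn.
  - by exists x; rewrite esym.
  - by rewrite /= esym xw.
  - by rewrite cons_uniq wp.
  - by move=> y; rewrite inE => /orP[/eqP->//|]; exact: disj.
have [/existsP[w /and3P[xw wc wp]]|no2] :=
    boolP [exists w, [&& e (last x p) w, w \notin c & w \notin x :: p]].
  apply: (IHn x (rcons p w)).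
  - by rewrite /= size_rcons addnS -addSn.
  - by [].
  - by rewrite rcons_path px.
  - by rewrite -rcons_cons rcons_uniq wp.
  - by move=> y; rewrite -rcons_cons mem_rcons inE => /orP[/eqP->//|]; exact: disj.
move: no1 no2 => /existsPn no1 /existsPn no2.
by apply: (second_cycle_maximal_path ex px up disj) => w ew;
  [have := no1 w | have := no2 w]; rewrite ew /= negb_and !negbK.
Qed.

End Ears.

(** A cycle exists because a maximal path has to return to itself: this is the
    argument above outside the empty sequence, which has no ears. *)
Lemma exists_simple_cycle u v : e u v -> exists c, simple_cycle c.
Proof.
move=> uv; have [||[c' ? _]|[c' [? _ _]]] := @second_cycle_outside [::] _ u v _ uv;
  by [|exists c'].
Qed.

(** An edge off the odd cycle [c] either leaves it or is a chord, and a chord is an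
    ear without interior vertices. *)
Lemma second_cycle_edge c u v : simple_cycle c -> odd (size c) -> e u v ->
  ~~ ((u \in c) && (v == next c u)) -> ~~ ((v \in c) && (u == next c v)) ->
  second_cycle c.
Proof.
move=> cc oc uv n1 n2.
have ear a b q : a \in c -> b \in c -> a != b -> q != [::] ->
    path e a (rcons q b) -> uniq q -> {in q, forall v, v \notin c} ->
    exists2 c', simple_cycle c' & ~~ odd (size c').
  by move=> ac bc ab q0 pq uq qc; apply: (ear_even_cycle cc oc ac bc ab pq uq qc); rewrite q0.
case: (boolP (u \in c)) n1 => [uc /= n1|uc _]; last exact: (second_cycle_outside ear uc uv).
case: (boolP (v \in c)) n2 => [vc /= n2|vc _]; last first.
  by apply: (second_cycle_outside ear vc (v := u)); rewrite esym.
left; apply: (@ear_even_cycle c u v [::]) => //=.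
- by apply: contraTneq uv => ->; rewrite eirr.
- by rewrite uv.
- by rewrite eq_sym n1 eq_sym n2.
Qed.

End Relation.
End Cycles.

(** * Edge sets of cycles *)

Section CycleEdges.
Context (V : finType).
Implicit Types (a b u v w x y : V) (c s : seq V) (S : {set V * V}).
Local Open Scope nat_scope.

(** A set of edges consists of ordered pairs with increasing ranks, as in the
    product that defines the density; [orient] picks the representative of an
    unordered pair. *)
Definition orient u v : V * V := if enum_rank u < enum_rank v then (u, v) else (v, u).

Definition oriented S := {in S, forall p, enum_rank p.1 < enum_rank p.2}.

Definition edge_rel S : rel V := fun u v => orient u v \in S.

Definition cycle_edges c : {set V * V} := [set orient v (next c v) | v in c].

Lemma orientC u v : orient u v = orient v u.
Proof.
rewrite /orient; case: ltngtP => // uv.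
by rewrite (enum_rank_inj (val_inj uv)).
Qed.

Lemma orientP u v : orient u v = (u, v) \/ orient u v = (v, u).
Proof. by rewrite /orient; case: ifP; [left|right]. Qed.

Lemma edge_rel_sym S : symmetric (edge_rel S).
Proof. by move=> u v; rewrite /edge_rel orientC. Qed.

Lemma edge_rel_irr S : oriented S -> irreflexive (edge_rel S).
Proof.
move=> oS u; apply/negP => /oS; rewrite /orient ltnn /=.
by rewrite ltnn.
Qed.

Lemma edge_relP S p : oriented S -> p \in S -> edge_rel S p.1 p.2.
Proof.
by move=> oS pS; have := oS p pS; rewrite /edge_rel /orient => ->; case: p pS.
Qed.

Lemma next_next_neq c v : 2 < size c -> uniq c -> v \in c ->
  next c (next c v) != v.
Proof.
move=> sc uc vc; case: (rot_to vc) => i p Ec.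
rewrite -!(next_rot i uc) Ec.
rewrite -(size_rot i) Ec in sc; rewrite -(rot_uniq i) Ec in uc.
case: p sc uc {Ec} => [//|w [//|z p]] _ /= /and3P[].
rewrite !inE !negb_or => /and3P[vw vz vp] _ _.
by rewrite eqxx [w == v]eq_sym (negbTE vw) eqxx eq_sym.
Qed.

Lemma next_neq c v : 2 < size c -> uniq c -> v \in c -> next c v != v.
Proof.
move=> sc uc vc; apply/eqP => E; have := next_next_neq sc uc vc.
by rewrite !E eqxx.
Qed.

(** Cycles of length at least three are needed here: two consecutive steps of a
    cycle of length two use the same edge. *)
Lemma cycle_edge_inj c : 2 < size c -> uniq c ->
  {in c &, injective (fun v => orient v (next c v))}.
Proof.
move=> sc uc v w vc wc E.
have : v = w \/ v = next c w /\ next c v = w.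
  by move: E; case: (orientP v (next c v)) => ->;
    case: (orientP w (next c w)) => -> [] ? ?; auto.
by case=> // -[E1 E2]; have := next_next_neq sc uc vc; rewrite E2 -E1 eqxx.
Qed.

Lemma card_cycle_edges c : 2 < size c -> uniq c -> #|cycle_edges c| = size c.
Proof.
move=> sc uc; rewrite card_in_imset; first exact/card_uniqP.
exact: cycle_edge_inj.
Qed.

Lemma cycle_edges_sub S c : simple_cycle (edge_rel S) c -> cycle_edges c \subset S.
Proof.
move=> /and3P[_ cc _]; apply/fintype.subsetP => p /imsetP[v vc ->].
exact: (next_cycle cc vc).
Qed.

(** A common edge would have two distinct common ends. *)
Lemma cycle_edges_disjoint c1 c2 : 2 < size c1 -> uniq c1 ->
  ncommon c1 c2 <= 1 -> [disjoint cycle_edges c1 & cycle_edges c2].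
Proof.
move=> s1 u1 n12; apply/pred0P => p /=; apply/negP => /andP[].
move=> /imsetP[v v1 ->] /imsetP[w w2] E.
have [vin nin] : v \in c2 /\ next c1 v \in c2.
  have w2' : next c2 w \in c2 by rewrite mem_next.
  by move: E; case: (orientP v (next c1 v)) => ->;
    case: (orientP w (next c2 w)) => -> [] -> ->.
have := next_neq s1 u1 v1; have := card_le1_eqP n12 (next c1 v) v.
by rewrite !inE mem_next v1 vin nin => /(_ isT isT) <-; rewrite eqxx.
Qed.

Lemma cycle_edges_rot n c : uniq c -> cycle_edges (rot n c) = cycle_edges c.
Proof.
move=> uc; apply/setP => p; apply/imsetP/imsetP => -[v vc ->]; exists v => //.
- by rewrite mem_rot in vc.
- by rewrite next_rot.
- by rewrite mem_rot.
- by rewrite next_rot.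
Qed.

Lemma next_pairs a s : uniq (a :: s) ->
  [seq (v, next (a :: s) v) | v <- a :: s] = pairmap pair a (rcons s a).
Proof.
move=> us; apply: (eq_from_nth (x0 := (a, a))).
  by rewrite size_map size_pairmap size_rcons.
move=> i; rewrite size_map => si.
rewrite (nth_map a)// (nth_pairmap a) ?size_rcons//.
rewrite next_nth mem_nth// index_uniq//.
congr (_, _).
- by rewrite -rcons_cons nth_rcons si.
- rewrite nth_rcons if_same; case: (ltnP i (size s)) => // is_.
  by rewrite nth_default.
Qed.

(** Since [S] has an even number of edges, it has an edge off any given odd cycle,
    and this edge produces a second cycle. *)
Lemma even_leafless_cycles S : oriented S -> S != finset.set0 -> ~~ odd #|S| ->
  (forall u v, edge_rel S u v -> exists2 w, w != v & edge_rel S u w) ->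
  (exists2 c, simple_cycle (edge_rel S) c & ~~ odd (size c)) \/
  (exists c1 c2, [/\ simple_cycle (edge_rel S) c1, simple_cycle (edge_rel S) c2,
     odd (size c1), odd (size c2) & ncommon c1 c2 <= 1]).
Proof.
move=> oS /set0Pn[p pS] evS nl.
have sym := edge_rel_sym S; have irr := edge_rel_irr oS.
have [c cc] := exists_simple_cycle sym irr nl (edge_relP oS pS).
case: (boolP (odd (size c))) => oc; last by left; exists c.
have /and3P[sc _ uc] := cc.
have /subsetPn[q qS qc] : ~~ (S \subset cycle_edges c).
  apply/negP => sub; have ES : S = cycle_edges c.
    by apply/eqP; rewrite finset.eqEsubset sub cycle_edges_sub.
  by move: evS; rewrite ES card_cycle_edges// oc.
have qE : orient q.1 q.2 = q.
  by rewrite /orient (oS q qS); case: (q).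
have [| |[c' cc' ec']|[c' [cc' oc' n]]] :=
    second_cycle_edge sym irr nl cc oc (edge_relP oS qS).
- apply: contra qc => /andP[qc /eqP E]; apply/imsetP.
  by exists q.1; rewrite -?E.
- apply: contra qc => /andP[qc /eqP E]; apply/imsetP.
  by exists q.2; rewrite -?E 1?orientC.
- by left; exists c'.
- by right; exists c, c'.
Qed.

End CycleEdges.

(** * Densities of cycles *)

Section CycleDensity.
Context {R : realType} (K : R * R -> R) (V : finType).
Hypotheses (bK : bmeas K) (Ksym : forall y z, K (y, z) = K (z, y)).
Implicit Types (a b u v : V) (c p s : seq V) (x : #|V|.-tuple R).

Lemma K_orient u v x :
  K (vcoord x (orient u v).1, vcoord x (orient u v).2) = K (vcoord x u, vcoord x v).
Proof. by case: (orientP u v) => ->. Qed.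

Lemma walk_weight_pairmap a p x :
  walk_weight K a p x = \prod_(q <- pairmap pair a p) K (vcoord x q.1, vcoord x q.2).
Proof.
by elim: p a => [|b p IHp] a /=; rewrite ?big_nil// big_cons IHp.
Qed.

Lemma walk_weight_cat a p q x :
  walk_weight K a (p ++ q) x = walk_weight K a p x * walk_weight K (last a p) q x.
Proof. by elim: p a => [|b p IHp] a /=; rewrite ?mul1r// IHp mulrA. Qed.

Lemma walk_weight_rev a s b x :
  walk_weight K a (rcons s b) x = walk_weight K b (rcons (rev s) a) x.
Proof.
elim: s a => [|v s IHs] a /=; first by rewrite Ksym.
by rewrite IHs rev_cons -[in RHS]cats1 walk_weight_cat last_rcons /= mulr1 mulrC Ksym.
Qed.

Lemma indep_walk_weight v a p : v \notin a :: p -> indep v (walk_weight K a p).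
Proof.
move=> vp x y; elim: p a vp => [//|b p IHp] a /=.
rewrite !inE !negb_or => /and3P[va vb vp].
by rewrite IHp ?inE ?negb_or ?vb// !vcoord_vupd_neq// eq_sym.
Qed.

Lemma edges_weight_cycle a s x : (2 < size (a :: s))%N -> uniq (a :: s) ->
  edges_weight K (cycle_edges (a :: s)) x = walk_weight K a (rcons s a) x.
Proof.
move=> sc uc; rewrite /edges_weight big_imset; last exact: cycle_edge_inj.
under eq_bigr do rewrite K_orient.
by rewrite -big_uniq// walk_weight_pairmap -next_pairs// big_map.
Qed.

(** Opposite vertices [u], [v] cut an even cycle into two walks of equal length.
    Integrating out their interiors gives twice the same factor. *)
Lemma cube_mean_even_cycle c : (2 < size c)%N -> uniq c -> ~~ odd (size c) ->
  exists m u v, u != v /\ cube_mean (edges_weight K (cycle_edges c)) =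
    cube_mean (fun x => kernel_pow K m (vcoord x u, vcoord x v) ^+ 2).
Proof.
case: c => [//|a s] sc uc ev.
have [m [s1 [b [s2 [sm1 sm2 Es]]]]] : exists m s1 b s2,
    [/\ size s1 = m, size s2 = m & s = s1 ++ b :: s2].
  exists (size s)./2, (take (size s)./2 s), (nth a s (size s)./2),
    (drop (size s)./2.+1 s).
  have ss : size s = (size s)./2.*2.+1.
    by move: ev => /=; rewrite negbK => o; rewrite -[LHS]odd_double_half o.
  split.
  - by rewrite size_take; case: ltnP => //; rewrite {1}ss; lia.
  - by rewrite size_drop {1}ss; lia.
  - by rewrite -drop_nth ?cat_take_drop// {2}ss; lia.
exists m, a, b; subst s.
move: (uc); rewrite /= mem_cat cat_uniq inE !negb_or /=.
move=> /and3P[/and3P[a1 ab a2] u1 /and3P[/andP[b1 h12] b2 u2]].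
split=> //.
transitivity (cube_mean (fun x => walk_weight K a (rcons s1 b) x *
    walk_weight K a (rcons (rev s2) b) x)).
  congr cube_mean; apply/funext => x; rewrite edges_weight_cycle//.
  rewrite rcons_cat /= -cat_rcons walk_weight_cat last_rcons; congr (_ * _).
  exact: walk_weight_rev.
rewrite cube_mean_walk//; first last.
- move=> v v1; apply: indep_walk_weight; rewrite inE mem_rcons inE mem_rev !negb_or.
  apply/and3P; split; first by apply: contraNneq a1 => <-.
    by apply: contraNneq b1 => <-.
  by apply/negP => v2; move/hasPn: h12 => /(_ v v2); rewrite /= v1.
- exact: bmeas_walk_weight.
transitivity (cube_mean (fun x => walk_weight K a (rcons (rev s2) b) x *
    kernel_pow K (size s1) (vcoord x a, vcoord x b))).
  by congr cube_mean; apply/funext => x; rewrite mulrC.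
have bk := bmeas_kernel_pow bK.
rewrite cube_mean_walk ?rev_uniq ?mem_rev//; first last.
- move=> v; rewrite mem_rev => v2 x y; rewrite !vcoord_vupd_neq//.
    by apply: contraNneq b2 => ->.
  by apply: contraNneq a2 => ->.
- exact: bmeas_vcoord2.
by rewrite size_rev sm1 sm2.
Qed.

(** Integrating out all vertices but one on each cycle leaves the product of the
    same function [h x = kernel_pow m (x, x)] at the two remaining vertices. If the
    cycles meet, the common vertex is kept, and the density is [\int h^2]; otherwise
    it is [(\int h)^2]. *)
Lemma cube_mean_two_cycles_ge0 c1 c2 :
  (2 < size c1)%N -> uniq c1 -> (2 < size c2)%N -> uniq c2 ->
  size c1 = size c2 -> (ncommon c1 c2 <= 1)%N ->
  0 <= cube_mean (edges_weight K (cycle_edges c1 :|: cycle_edges c2)).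
Proof.
move=> sc1 uc1 sc2 uc2 sz n.
have disj := cycle_edges_disjoint sc1 uc1 n.
have [a [b [a1 b2 abP]]] : exists a b, [/\ a \in c1, b \in c2 &
    forall v, v \in c1 -> v \in c2 -> v = a /\ v = b].
  case: (set_0Vmem ([set v in c1] :&: [set v in c2])) => [E0|[v]].
    case: c1 sc1 {uc1 sz n disj} E0 => // a c1 _ E0.
    case: c2 sc2 {uc2} E0 => // b c2 _ E0.
    exists a, b; split; rewrite ?mem_head// => v v1 v2.
    by have := finset.in_set0 v; rewrite -E0 !inE in v1 v2 *; rewrite v1 v2.
  rewrite !inE => /andP[v1 v2]; exists v, v; split=> // w w1 w2.
  by have := card_le1_eqP n w v; rewrite !inE w1 w2 v1 v2 => /(_ isT isT).
case: (rot_to a1) => i s1 E1; case: (rot_to b2) => j s2 E2.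
rewrite -(cycle_edges_rot i uc1) -(cycle_edges_rot j uc2) E1 E2 in disj *.
rewrite -(size_rot i) -(size_rot j c2) E1 E2 in sz.
rewrite -(rot_uniq i) E1 in uc1; rewrite -(rot_uniq j) E2 in uc2.
rewrite -(size_rot i) E1 in sc1; rewrite -(size_rot j) E2 in sc2.
have {}abP v : v \in a :: s1 -> v \in b :: s2 -> v = a /\ v = b.
  by rewrite -E1 -E2 !mem_rot; exact: abP.
case/andP: (uc1) => as1 us1; case/andP: (uc2) => bs2 us2.
have [m [sm1 sm2]] : exists m, size s1 = m /\ size s2 = m.
  by exists (size s1); case: sz => ->.
have bk := bmeas_kernel_pow bK.
have -> : cube_mean (edges_weight K (cycle_edges (a :: s1) :|: cycle_edges (b :: s2))) =
    cube_mean (fun x => kernel_pow K m (vcoord x a, vcoord x a) *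
      kernel_pow K m (vcoord x b, vcoord x b)).
  transitivity (cube_mean (fun x => walk_weight K a (rcons s1 a) x *
      walk_weight K b (rcons s2 b) x)).
    congr cube_mean; apply/funext => x.
    rewrite -(edges_weight_cycle _ sc1 uc1) -(edges_weight_cycle _ sc2 uc2) /edges_weight -bigU//.
    by apply: eq_bigl => p; rewrite inE.
  rewrite cube_mean_walk//; first last.
  - move=> v v1; apply: indep_walk_weight; rewrite inE mem_rcons !inE negb_or negb_or.
    have /negP vb : ~ v \in b :: s2.
      by move=> /abP[|va _]; [rewrite inE v1 orbT | rewrite -va v1 in as1].
    by move: vb; rewrite inE negb_or => /andP[-> ->].
  - exact: bmeas_walk_weight.
  transitivity (cube_mean (fun x => walk_weight K b (rcons s2 b) x *
      kernel_pow K (size s1) (vcoord x a, vcoord x a))).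
    by congr cube_mean; apply/funext => x; rewrite mulrC.
  rewrite cube_mean_walk//; first last.
  - move=> v v2 x y; rewrite !vcoord_vupd_neq//; apply: contraNneq bs2 => av.
    have [] := abP v; rewrite ?inE ?v2 ?orbT -?av ?eqxx// => _.
    by move=> <-; rewrite av.
  - exact: bmeas_vcoord2.
  by rewrite sm1 sm2; congr cube_mean; apply/funext => x; rewrite mulrC.
have [->|ab] := eqVneq a b; first by apply: cube_mean_ge0 => x; exact: sqr_ge0.
pose h y := kernel_pow K m (y, y).
have bh : bmeas h by apply: bmeas_pair.
rewrite (cube_mean_vcoord2 (h := fun q => h q.1 * h q.2))//; last first.
  by apply: bmeasM; [exact: bmeas_fst|exact: bmeas_snd].
have -> : (fun y => mean01 (fun z => h y * h z)) = (fun y => mean01 h * h y).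
  by apply/funext => y; rewrite mean01Z// mulrC.
by rewrite mean01Z//; exact: sqr_ge0.
Qed.

End CycleDensity.

(** * Densities with two edges, with a leaf, and the sign of a polynomial near zero *)

Section LowOrder.
Context {R : realType} (K : R * R -> R) (V : finType).
Hypotheses (bK : bmeas K) (Ksym : forall y z, K (y, z) = K (z, y)).
Implicit Types (u v w : V) (S : {set V * V}) (x : #|V|.-tuple R).

Lemma touches_orient u v w : touches (orient u v) w = (w == u) || (w == v).
Proof. by rewrite /touches; case: (orientP u v) => -> //=; rewrite orbC. Qed.

Lemma oriented_orient S q u : oriented S -> q \in S -> touches q u ->
  exists2 v, u != v & q = orient u v.
Proof.
move=> oS qS; have := oS q qS; case: q qS => a b /= qS lt_ab.
have ab : a != b by apply: contraTneq lt_ab => ->; rewrite ltnn.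
have E : orient a b = (a, b) by rewrite /orient lt_ab.
by case/orP => /eqP ->; [exists b | exists a; rewrite 1?eq_sym// orientC].
Qed.

Lemma orientI_eq u v w : u != v -> orient u v = orient u w -> v = w.
Proof.
move=> uv; case: (orientP u v) => ->; case: (orientP u w) => -> [] //.
- by move=> _ vu; rewrite vu eqxx in uv.
- by move=> vu; rewrite vu eqxx in uv.
Qed.

Lemma cube_mean_edges_weight_leaf S u v : u != v -> orient u v \in S ->
  {in S, forall q, touches q v -> q = orient u v} ->
  cube_mean (edges_weight K S) =
  cube_mean (fun x => kernel_degree K (vcoord x u) * edges_weight K (S :\ orient u v) x).
Proof.
move=> uv pS leaf.
transitivity (cube_mean (fun x => K (vcoord x u, vcoord x v) *
    edges_weight K (S :\ orient u v) x)).
  congr cube_mean; apply/funext => x.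
  by rewrite /edges_weight (big_setD1 _ pS) /= K_orient.
apply: cube_mean_leaf => //; first exact: bmeas_edges_weight.
apply: indep_edges_weight => q; rewrite !inE => /andP[qp qS].
by apply: contra qp => qv; rewrite (leaf q).
Qed.

(** Integrating out the leaf [v] turns the weight into the product of the degree of
    [u] and a bounded function. *)
Lemma cube_mean_edges_weight_leaf_eq0 S u v : u != v -> orient u v \in S ->
  {in S, forall q, touches q v -> q = orient u v} ->
  mean01 (fun y => kernel_degree K y ^+ 2) = 0 -> cube_mean (edges_weight K S) = 0.
Proof.
move=> uv pS leaf d0; rewrite (cube_mean_edges_weight_leaf uv)//.
have bd := bmeas_kernel_degree bK.
apply: cube_mean_sqr_eq0.
- exact: bmeas_vcoord.
- exact: bmeas_edges_weight.
- by rewrite (cube_mean_vcoord _ (h := fun y => kernel_degree K y ^+ 2))//; exact: bmeasX.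
Qed.

(** An edge that meets no other edge of [S] contributes the factor [\int d]. *)
Lemma cube_mean_edges_weight_isolated_eq0 S u v : u != v -> orient u v \in S ->
  {in S, forall q, touches q u || touches q v -> q = orient u v} ->
  mean01 (kernel_degree K) = 0 -> cube_mean (edges_weight K S) = 0.
Proof.
move=> uv pS iso d0; rewrite (cube_mean_edges_weight_leaf uv)//; last first.
  by move=> q qS qv; apply: iso; rewrite // qv orbT.
have bd := bmeas_kernel_degree bK.
rewrite -[RHS](cube_mean_cst #|V|); apply: (cube_mean_cond (v := u)).
  by apply: bmeasM; [exact: bmeas_vcoord|exact: bmeas_edges_weight].
have iu : indep u (edges_weight K (S :\ orient u v)).
  apply: indep_edges_weight => q; rewrite !inE => /andP[qp qS].
  by apply: contra qp => qu; rewrite (iso q)// qu.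
move=> x; rewrite -[RHS](mulr0 (edges_weight K (S :\ orient u v) x)) -d0 -mean01Z//.
by congr mean01; apply/funext => y; rewrite iu vcoord_vupd_id mulrC.
Qed.

Lemma edges_weight1 q x : edges_weight K [set q] x = K (vcoord x q.1, vcoord x q.2).
Proof. exact: big_set1. Qed.

Lemma cube_mean_cherry u v w : u != v -> u != w -> v != w ->
  cube_mean (edges_weight K [set orient u v; orient u w]) =
  mean01 (fun y => kernel_degree K y ^+ 2).
Proof.
move=> uv uw vw; have bd := bmeas_kernel_degree bK.
have pq : orient u v != orient u w.
  by apply: contra_neq vw; exact: orientI_eq.
rewrite (cube_mean_edges_weight_leaf uv) ?set21//; last first.
  move=> q; rewrite !inE => /orP[/eqP//|/eqP ->].
  by rewrite touches_orient eq_sym (negbTE uv) (negbTE vw).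
have -> : [set orient u v; orient u w] :\ orient u v = [set orient u w].
  apply/setP => q; rewrite !inE; case: eqVneq => //= ->.
  by rewrite (negbTE pq).
transitivity (cube_mean (fun x => K (vcoord x u, vcoord x w) * kernel_degree K (vcoord x u))).
  by congr cube_mean; apply/funext => x; rewrite edges_weight1 K_orient// mulrC.
rewrite cube_mean_leaf//; last 2 first.
- exact: bmeas_vcoord.
- by move=> x y; rewrite vcoord_vupd_neq.
by rewrite (cube_mean_vcoord _ (h := fun y => kernel_degree K y * kernel_degree K y))//; exact: bmeasM.
Qed.

Lemma cube_mean_two_edges u v w z : u != v -> w != z -> u != w -> u != z ->
  v != w -> v != z ->
  cube_mean (edges_weight K [set orient u v; orient w z]) = mean01 (kernel_degree K) ^+ 2.
Proof.
move=> uv wz uw uz vw vz; have bd := bmeas_kernel_degree bK.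
have pq : orient u v != orient w z.
  by apply: contra_neq uw; case: (orientP u v) => ->; case: (orientP w z) => -> [];
   [ | move=> E; rewrite E eqxx in uz | move=> E; rewrite E eqxx in vw |].
rewrite (cube_mean_edges_weight_leaf uv) ?set21//; last first.
  move=> q; rewrite !inE => /orP[/eqP//|/eqP ->].
  by rewrite touches_orient (negbTE vw) (negbTE vz).
have -> : [set orient u v; orient w z] :\ orient u v = [set orient w z].
  apply/setP => q; rewrite !inE; case: eqVneq => //= ->.
  by rewrite (negbTE pq).
transitivity (cube_mean (fun x => K (vcoord x w, vcoord x z) * kernel_degree K (vcoord x u))).
  by congr cube_mean; apply/funext => x; rewrite edges_weight1 K_orient// mulrC.
rewrite cube_mean_leaf//; last 2 first.
- exact: bmeas_vcoord.
- by move=> x y; rewrite vcoord_vupd_neq.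
rewrite (cube_mean_vcoord2 (h := fun q => kernel_degree K q.1 * kernel_degree K q.2))//; last 2 first.
- by rewrite eq_sym.
- by apply: bmeasM; [exact: bmeas_fst|exact: bmeas_snd].
have -> : (fun y => mean01 (fun z => kernel_degree K y * kernel_degree K z)) =
    (fun y => mean01 (kernel_degree K) * kernel_degree K y).
  by apply/funext => y; rewrite mean01Z// mulrC.
by rewrite mean01Z// expr2.
Qed.

End LowOrder.

(** The lowest order at which a coefficient is nonzero decides the sign. *)
Lemma eventually_ge0 (R : realType) (J : finType) (n : J -> nat) (a : J -> R) m :
  (forall j, (n j < m)%N -> a j = 0) -> (forall j, n j = m -> 0 <= a j) ->
  (exists2 j, n j = m & 0 < a j) ->
  exists2 e0, 0 < e0 & forall e, 0 <= e <= e0 -> 0 <= \sum_j a j * e ^+ n j.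
Proof.
move=> lt_m eq_m [i nim ai].
pose M := \sum_j `|a j|.
have M0 : 0 <= M by apply: sumr_ge0.
have M1 : 0 < 1 + M by lra.
exists (Num.min 1 (a i / (1 + M))).
  by rewrite lt_min ltr01 divr_gt0.
move=> e; rewrite le_min => /and3P[e0 e1].
rewrite ler_pdivlMr// => eM.
have em0 : 0 <= e ^+ m by rewrite exprn_ge0.
have term j : j != i -> - (`|a j| * e ^+ m.+1) <= a j * e ^+ n j.
  move=> _; case: (ltngtP (n j) m) => nm.
  - by rewrite lt_m// normr0 !mul0r oppr0.
  - have en : e ^+ n j <= e ^+ m.+1 by apply: ler_wiXn2l.
    have en0 : 0 <= e ^+ n j by rewrite exprn_ge0.
    apply: (@le_trans _ _ (- (`|a j| * e ^+ n j))).
      by rewrite lerN2 ler_wpM2l.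
    by rewrite -mulNr ler_wpM2r// lerNl -normrN ler_norm.
  - have aj := eq_m j nm; rewrite nm.
    apply: (@le_trans _ _ 0); last by rewrite mulr_ge0.
    by rewrite oppr_le0 mulr_ge0// exprn_ge0.
rewrite (bigD1 i)//= nim.
have : - (M * e ^+ m.+1) <= \sum_(j | j != i) a j * e ^+ n j.
  apply: (@le_trans _ _ (\sum_(j | j != i) - (`|a j| * e ^+ m.+1))); last first.
    by apply: ler_sum => j ji; exact: term.
  rewrite sumrN -mulr_suml lerN2 ler_wpM2r ?exprn_ge0//.
  by rewrite /M [leRHS](bigD1 i)//= lerDr.
rewrite exprS; set s := \sum_(_ | _) _; set t := e ^+ m in em0 *.
have : 0 <= (a i - e * (1 + M)) * t by rewrite mulr_ge0// subr_ge0.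
have : 0 <= e * t by rewrite mulr_ge0.
lra.
Qed.

(** * Expansion of the density and critical subgraphs *)

Section Expansion.
Context {R : realType} (F : sgraph) (U : R * R -> R).
Hypothesis U1 : is_kernel U.

(** Only the values of a kernel on the unit square matter. Extending it by zero makes
    measurability, symmetry and boundedness hold everywhere. *)
Definition ext_kernel (p : R * R) : R :=
  if (p.1 \in `[0, 1]) && (p.2 \in `[0, 1]) then U p else 0.

Lemma bmeas_ext_kernel : bmeas ext_kernel.
Proof.
case: U1 => mU _ [M UM]; split; last first.
  exists (Num.max M 0) => -[y z]; rewrite /ext_kernel /=.
  case: ifP => [/andP[yI zI]|_]; last by rewrite normr0 le_max lexx orbT.
  by rewrite le_max UM.
have -> : ext_kernel = (U \_ (`[0, 1] `*` `[0, 1]))%classic.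
  by apply/funext => -[y z]; rewrite patchE in_setX /ext_kernel /= !mem_setE.
by apply/measurable_restrict => //; rewrite ?setTI; first by apply: measurableX; exact: measurable_itv.
Qed.

Lemma ext_kernel_sym y z : ext_kernel (y, z) = ext_kernel (z, y).
Proof.
rewrite /ext_kernel /= andbC; case: ifP => // /andP[zI yI].
by case: U1 => _ sym _; exact: sym.
Qed.

Definition edge_set : {set F * F} :=
  [set p | adj p.1 p.2 && (enum_rank p.1 < enum_rank p.2)%N].

Lemma oriented_edge_set : oriented edge_set.
Proof. by move=> p; rewrite inE => /andP[]. Qed.

Lemma edge_rel_sub (S : {set F * F}) : S \subset edge_set ->
  subrel (edge_rel S) (@adj F).
Proof.
move=> SE u v /(fintype.subsetP SE); rewrite inE.
by case: (orientP u v) => -> /andP[] //=; rewrite adj_sym.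
Qed.

Lemma hom_densityE (e : R) :
  hom_density F (fun p => 1 + e * U p) =
  \sum_(S : {set F * F} | S \subset edge_set)
    e ^+ #|S| * cube_mean (edges_weight ext_kernel S).
Proof.
have bK := bmeas_ext_kernel.
transitivity (cube_mean (fun x => \sum_(S : {set F * F} | S \subset edge_set)
    e ^+ #|S| * edges_weight ext_kernel S x)); last first.
  rewrite cube_mean_sum; last first.
    by move=> S; apply: bmeasM; [exact: bmeas_cst|exact: bmeas_edges_weight].
  by apply: eq_bigr => S _; rewrite cube_meanZ//; exact: bmeas_edges_weight.
apply: eq_Rintegral => x; rewrite inE => xI.
pose f p : R := if p \in edge_set then e * ext_kernel (vcoord x p.1, vcoord x p.2) else 0.
transitivity (\prod_(p : F * F) (f p + 1)).
  rewrite big_mkcond; apply: eq_bigr => p _; rewrite /f inE.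
  case: ifP => _; last by rewrite add0r.
  by rewrite addrC /ext_kernel /= !xI.
rewrite bigA_distr [RHS]big_mkcond; apply: eq_bigr => S _.
rewrite -big_mkcond /=; case: ifPn => [SE|/subsetPn[p pS pE]]; last first.
  by rewrite (big_setD1 _ pS) /= /f (negbTE pE) mul0r.
rewrite -prodr_const -big_split /=; apply: eq_bigr => p pS.
by rewrite /f (fintype.subsetP SE).
Qed.

Lemma hom_density_sum (e : R) :
  hom_density F (fun p => 1 + e * U p) + hom_density F (fun p => 1 - e * U p) =
  2 + \sum_(S : {set F * F})
    (if [&& S \subset edge_set, S != finset.set0 & ~~ odd #|S|]
     then 2 * cube_mean (edges_weight ext_kernel S) else 0) * e ^+ #|S|.
Proof.
have -> : hom_density F (fun p => 1 - e * U p) =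
    hom_density F (fun p => 1 + (- e) * U p).
  by congr hom_density; apply/funext => p; rewrite mulNr.
rewrite !hom_densityE -big_split /= [LHS]big_mkcond (bigD1 finset.set0)//=.
rewrite finset.sub0set cards0 !expr0 !mul1r.
have -> : cube_mean (edges_weight ext_kernel (finset.set0 : {set F * F})) = 1.
  rewrite -[RHS](cube_mean_cst #|F|); congr cube_mean; apply/funext => x.
  by rewrite /edges_weight big_set0.
rewrite [in RHS](bigD1 finset.set0)//= eqxx andbF mul0r add0r.
congr (_ + _); apply: eq_bigr => S S0; rewrite S0 /=.
case: ifP => _ /=; last by rewrite mul0r.
rewrite exprNn; case: (boolP (odd #|S|)) => o.
  by rewrite -signr_odd o expr1 /=; ring.
by rewrite -signr_odd (negbTE o) expr0 /=; ring.
Qed.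

End Expansion.

Lemma g_even_ge (R : realType) (F : sgraph) (n : nat) :
  (forall c : seq F, is_cycle c -> ~~ odd (size c) -> (n <= size c)%N) ->
  (n%:R%:E <= g_even R F)%E.
Proof.
move=> H; apply: le_ereal_inf_tmp => _ [c /= /andP[cc ec] <-].
by rewrite lee_fin ler_nat H.
Qed.

Section Critical.
Context (F : sgraph).

(** The negation of the conclusion of the theorem, with an upper bound on the even
    girth expressed by an even cycle. The boolean [size c1 < size c2], read as 0 or
    1, separates the strict from the weak inequality. *)
Definition short_even_cycles : Prop := forall c1 c2 : seq F,
  is_cycle c1 -> is_cycle c2 -> odd (size c1) -> odd (size c2) ->
  (ncommon c1 c2 <= 1)%N -> (size c1 <= size c2)%N ->
  exists c : seq F, [/\ is_cycle c, ~~ odd (size c) &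
    (size c + (size c1 < size c2) <= size c1 + size c2)%N].

Definition leafless (S : {set F * F}) : Prop :=
  forall u v, edge_rel S u v -> exists2 w, w != v & edge_rel S u w.

Lemma simple_cycle_sub (S : {set F * F}) (c : seq F) : S \subset edge_set F ->
  simple_cycle (edge_rel S) c -> is_cycle c.
Proof.
move=> SE /and3P[sc cc uc]; rewrite /is_cycle sc /ucycleb uc andbT /=.
exact: (sub_cycle (edge_rel_sub SE) cc).
Qed.

Lemma ncommonC (c1 c2 : seq F) : ncommon c1 c2 = ncommon c2 c1.
Proof. by rewrite /ncommon finset.setIC. Qed.

(** The cycles found in [S] use at least as many edges as the shortest even cycle of
    [F] has, and [S] has no more than that: so they use up all the edges of [S]. Two
    odd cycles of different lengths would, by [short_even_cycles], come with an even
    cycle shorter than their total length. *)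
Lemma critical_leafless (S : {set F * F}) : short_even_cycles ->
  S \subset edge_set F -> S != finset.set0 -> ~~ odd #|S| -> leafless S ->
  (forall c : seq F, is_cycle c -> ~~ odd (size c) -> (#|S| <= size c)%N) ->
  (exists c : seq F, [/\ is_cycle c, ~~ odd (size c), size c = #|S| &
     S = cycle_edges c]) \/
  (exists c1 c2 : seq F, [/\ is_cycle c1, is_cycle c2, size c1 = size c2,
     (ncommon c1 c2 <= 1)%N & S = cycle_edges c1 :|: cycle_edges c2] /\
     exists c : seq F, [/\ is_cycle c, ~~ odd (size c) & size c = #|S|]).
Proof.
move=> sec SE S0 evS nl small.
have oS : oriented S by move=> p /(fintype.subsetP SE); exact: oriented_edge_set.
case: (even_leafless_cycles oS S0 evS nl) => [[c cc ec]|[c1 [c2 [cc1 cc2 o1 o2 n]]]].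
  left; exists c; have ccF := simple_cycle_sub SE cc.
  have sub := cycle_edges_sub cc.
  case/and3P: cc => sc _ uc; have card := card_cycle_edges sc uc.
  have szc : size c = #|S|.
    by apply/eqP; rewrite eqn_leq small// andbT -card subset_leq_card.
  split=> //; apply/eqP; rewrite eq_sym eqEcard sub card szc leqnn //.
right.
wlog le12 : c1 c2 cc1 cc2 o1 o2 n / (size c1 <= size c2)%N.
  move=> W; case: (leqP (size c1) (size c2)) => [le|/ltnW le]; first exact: (W c1 c2).
  by apply: (W c2 c1) => //; rewrite ncommonC.
have [sub1 sub2] := (cycle_edges_sub cc1, cycle_edges_sub cc2).
have [F1 F2] := (simple_cycle_sub SE cc1, simple_cycle_sub SE cc2).
have [c [cc ec szc]] := sec c1 c2 F1 F2 o1 o2 n le12.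
case/and3P: cc1 => s1 _ u1; case/and3P: cc2 => s2 _ u2.
have disj := cycle_edges_disjoint s1 u1 n.
have card : #|cycle_edges c1 :|: cycle_edges c2| = (size c1 + size c2)%N.
  by rewrite cardsU (disjoint_setI0 disj) cards0 subn0 !card_cycle_edges.
have sub : cycle_edges c1 :|: cycle_edges c2 \subset S by rewrite finset.subUset sub1.
have le := subset_leq_card sub; rewrite card in le.
have le_c := leq_trans le (small c cc ec).
have ge_c : (size c <= size c1 + size c2)%N by exact: leq_trans (leq_addr _ _) szc.
have le21 : (size c2 <= size c1)%N.
  rewrite leqNgt; apply/negP => lt12.
  by have := leq_trans szc le_c; rewrite lt12 addn1 ltnn.
have S12 : #|S| = (size c1 + size c2)%N.
  by apply/eqP; rewrite eqn_leq le (leq_trans (small c cc ec)).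
exists c1, c2; split; last first.
  by exists c; split=> //; rewrite S12; apply/eqP; rewrite eqn_leq ge_c.
split=> //; first by apply/eqP; rewrite eqn_leq le12.
by apply/eqP; rewrite eq_sym eqEcard sub card S12 leqnn.
Qed.

End Critical.

Section WeaklyLocallyCommon.
Context {R : realType} (F : sgraph).
Hypothesis sec : short_even_cycles F.
Context (K : R * R -> R).
Hypotheses (bK : bmeas K) (Ksym : forall y z, K (y, z) = K (z, y)).

Local Notation t S := (cube_mean (edges_weight K S)).
Local Notation E := (edge_set F).

Lemma critical_ge0 (S : {set F * F}) :
  S \subset E -> S != finset.set0 -> ~~ odd #|S| -> leafless S ->
  (forall c : seq F, is_cycle c -> ~~ odd (size c) -> (#|S| <= size c)%N) ->
  0 <= t S /\ exists c : seq F, [/\ is_cycle c, ~~ odd (size c) & size c = #|S|].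
Proof.
move=> SE S0 evS nl small.
case: (critical_leafless sec SE S0 evS nl small) =>
    [[c [cc ec sz ->]]|[c1 [c2 [[cc1 cc2 sz n ->] ex]]]].
  split; last by exists c; split=> //; rewrite sz card_cycle_edges//; case/and3P: cc.
  case/and3P: cc => sc _ uc.
  have [m [u [v [uv ->]]]] := cube_mean_even_cycle bK Ksym sc uc ec.
  by apply: cube_mean_ge0 => x; exact: sqr_ge0.
by split=> //; case/and3P: cc1 => s1 _ u1; case/and3P: cc2 => s2 _ u2;
  exact: cube_mean_two_cycles_ge0.
Qed.

Lemma leafy_eq0 (S : {set F * F}) : oriented S -> ~ leafless S ->
  mean01 (fun y => kernel_degree K y ^+ 2) = 0 -> t S = 0.
Proof.
move=> oS nl d0.
have [v [u [vu only]]] : exists v u, edge_rel S v u /\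
    forall w, edge_rel S v w -> w = u.
  apply: contrapT => H; apply: nl => v u vu; apply: contrapT => H'.
  apply: H; exists v, u; split=> // w vw; apply: contrapT => wu.
  by apply: H'; exists w => //; exact/eqP.
have uv : u != v.
  by apply: contraTneq vu => ->; rewrite edge_rel_irr.
apply: (cube_mean_edges_weight_leaf_eq0 bK Ksym (u := u) (v := v)) => //.
  by rewrite orientC.
move=> q qS qv; have [w _ Eq] := oriented_orient oS qS qv.
have wu : w = u by apply: only; rewrite /edge_rel -Eq.
by rewrite Eq wu orientC.
Qed.

Lemma edge_set_cases (S : {set F * F}) : S \subset E -> #|S| = 2%N ->
  (exists u v w, [/\ u != v, u != w, v != w & S = [set orient u v; orient u w]]) \/
  (t S = mean01 (kernel_degree K) ^+ 2 /\ exists p q, [/\ p \in E, q \in E, p != q &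
     forall u, ~~ (touches p u && touches q u)]).
Proof.
move=> SE S2.
have /cards2P[p [q [pq ES]]] : #|S| == 2 by rewrite S2.
have [pE qE] : p \in E /\ q \in E.
  by split; apply: (fintype.subsetP SE); rewrite ES !inE eqxx ?orbT.
have oE := @oriented_edge_set F.
case: (boolP [exists u, touches p u && touches q u]) => [/existsP[u /andP[pu qu]]|].
  left; have [v uv Ep] := oriented_orient oE pE pu.
  have [w uw Eq] := oriented_orient oE qE qu.
  exists u, v, w; split=> //; last by rewrite ES Ep Eq.
  by apply: contra_neq pq => vw; rewrite Ep Eq vw.
rewrite negb_exists => /forallP no; right; split; last by exists p, q.
have [|v uv Ep] := @oriented_orient _ E p p.1 oE pE; first by rewrite /touches eqxx.
have [|z wz Eq] := @oriented_orient _ E q q.1 oE qE; first by rewrite /touches eqxx.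
rewrite ES Ep Eq cube_mean_two_edges//.
all: apply/negP => /eqP EE.
- by have := no p.1; rewrite {1}Ep {1}Eq !touches_orient eqxx EE eqxx.
- by have := no p.1; rewrite {1}Ep {1}Eq !touches_orient eqxx EE eqxx orbT.
- by have := no v; rewrite {1}Ep {1}Eq !touches_orient eqxx EE eqxx orbT.
- by have := no v; rewrite {1}Ep {1}Eq !touches_orient eqxx EE eqxx !orbT.
Qed.

(** The order [m] is 2 if some two edges have nonzero density, and the even girth of
    [F] otherwise. *)
Lemma lowest_coefficient :
  (exists m, [/\ forall S : {set F * F}, S \subset E -> S != finset.set0 ->
        ~~ odd #|S| -> (#|S| < m)%N -> t S = 0,
      forall S : {set F * F}, S \subset E -> S != finset.set0 -> ~~ odd #|S| ->
        #|S| = m -> 0 <= t S &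
      exists S : {set F * F}, [/\ S \subset E, S != finset.set0, ~~ odd #|S|,
        #|S| = m & 0 < t S]]) \/
  (forall S : {set F * F}, S \subset E -> S != finset.set0 -> ~~ odd #|S| -> t S = 0).
Proof.
have oS (S : {set F * F}) : S \subset E -> oriented S.
  by move=> SE p /(fintype.subsetP SE); exact: oriented_edge_set.
have ge2 (S : {set F * F}) : S != finset.set0 -> ~~ odd #|S| -> (1 < #|S|)%N.
  by rewrite -card_gt0; case: #|S| => [//|[]].
have two_ge0 (S : {set F * F}) : S \subset E -> #|S| = 2%N -> 0 <= t S.
  move=> SE S2; case: (edge_set_cases SE S2) => [[u [v [w [uv uw vw ->]]]]|[-> _]].
    by rewrite cube_mean_cherry//; apply: mean01_ge0 => y; exact: sqr_ge0.
  exact: sqr_ge0.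
case: (pselect (exists S : {set F * F}, [/\ S \subset E, #|S| = 2%N & t S != 0])).
  move=> [S0 [S0E S02 S0n]]; left; exists 2%N; split.
  - by move=> S _ Sn ev; rewrite ltnNge ge2.
  - by move=> S SE _ _ S2; exact: two_ge0.
  - exists S0; split=> //; rewrite ?S02// -?card_gt0 ?S02//.
    by rewrite lt_neqAle eq_sym S0n two_ge0.
move=> no2.
have two0 (S : {set F * F}) : S \subset E -> #|S| = 2%N -> t S = 0.
  by move=> SE S2; apply/eqP/negPn/negP => tS; apply: no2; exists S.
case: (pselect (exists u v w, [/\ u != v, u != w, v != w &
    [set orient u v; orient u w] \subset E])); last first.
  move=> nocherry; right=> S SE Sn ev.
  have : (1 < #|S|)%N by exact: ge2.
  case/card_gt1P => p [q [pS qS pq]].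
  have pE := fintype.subsetP SE _ pS; have qE := fintype.subsetP SE _ qS.
  have oE := @oriented_edge_set F.
  have disj q' u : q' \in E -> touches p u -> touches q' u -> q' = p.
    move=> q'E pu qu; apply/eqP/negPn/negP => qp; apply: nocherry.
    have [v uv Ep] := oriented_orient oE pE pu.
    have [w uw Eq] := oriented_orient oE q'E qu.
    exists u, v, w; split=> //.
      by apply: contra_neq qp => vw; rewrite Ep Eq vw.
    by rewrite finset.subUset !finset.sub1set -Ep -Eq pE.
  have d0 : mean01 (kernel_degree K) = 0.
    have SE2 : [set p; q] \subset E by rewrite finset.subUset !finset.sub1set pE.
    have S2 : #|[set p; q]| = 2%N by rewrite cards2 pq.
    case: (edge_set_cases SE2 S2) => [[u [v [w [uv uw vw ES]]]]|[Et _]].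
      by case: nocherry; exists u, v, w; split=> //; rewrite -ES.
    by move: (two0 _ SE2 S2); rewrite Et => /eqP; rewrite sqrf_eq0 => /eqP.
  have [|v uv Ep] := @oriented_orient _ E p p.1 oE pE; first by rewrite /touches eqxx.
  apply: (cube_mean_edges_weight_isolated_eq0 bK Ksym (u := p.1) (v := v)) => //.
    by rewrite -Ep.
  move=> q' q'S H; rewrite -Ep; have q'E := fintype.subsetP SE _ q'S.
  case/orP: H => H; apply: disj q'E _ H; rewrite {1}Ep touches_orient eqxx ?orbT//.
move=> [u0 [v0 [w0 [uv0 uw0 vw0 cherryE]]]].
have d0 : mean01 (fun y => kernel_degree K y ^+ 2) = 0.
  rewrite -(cube_mean_cherry bK Ksym uv0 uw0 vw0); apply: two0 => //.
  rewrite cards2; case: eqP => // /(orientI_eq uv0) vw.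
  by rewrite vw eqxx in vw0.
case: (pselect (exists c : seq F, is_cycle c && ~~ odd (size c))); last first.
  move=> noeven; right=> S SE Sn ev.
  case: (pselect (leafless S)) => nl; last by apply: leafy_eq0 => //; exact: oS.
  have [|_ [c [cc ec _]]] := critical_ge0 SE Sn ev nl.
    by move=> c cc ec; case: noeven; exists c; rewrite cc.
  by case: noeven; exists c; rewrite cc.
move=> exeven.
have exn : exists n, `[< exists c : seq F, [/\ is_cycle c, ~~ odd (size c) & size c = n] >].
  by case: exeven => c /andP[cc ec]; exists (size c); apply/asboolP; exists c.
case: (ex_minnP exn) => g /asboolP[c [cc ec szc]] ming.
have small (c' : seq F) : is_cycle c' -> ~~ odd (size c') -> (g <= size c')%N.
  by move=> cc' ec'; apply: ming; apply/asboolP; exists c'.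
have below (S : {set F * F}) : S \subset E -> S != finset.set0 -> ~~ odd #|S| ->
    (#|S| < g)%N -> t S = 0.
  move=> SE Sn ev lt_g.
  case: (pselect (leafless S)) => nl; last by apply: leafy_eq0 => //; exact: oS.
  have [|_ [c' [cc' ec' sz]]] := critical_ge0 SE Sn ev nl.
    by move=> c' cc' ec'; exact: (leq_trans (ltnW lt_g) (small _ cc' ec')).
  by have := small _ cc' ec'; rewrite sz leqNgt lt_g.
have at_g (S : {set F * F}) : S \subset E -> S != finset.set0 -> ~~ odd #|S| ->
    #|S| = g -> 0 <= t S.
  move=> SE Sn ev eq_g.
  case: (pselect (leafless S)) => nl; last by rewrite leafy_eq0 //; exact: oS.
  have [|//] := critical_ge0 SE Sn ev nl.
  by move=> c' cc' ec'; rewrite eq_g; exact: small.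
case/and3P: (cc) => sc cyc uc.
have card := card_cycle_edges sc uc.
have cE : cycle_edges c \subset E.
  apply/fintype.subsetP => _ /imsetP[v vc ->]; have := next_cycle cyc vc.
  rewrite /orient; case: ltngtP => [vw av|wv av|/val_inj/enum_rank_inj <-].
  - by rewrite inE /= av.
  - by rewrite inE /= adj_sym av.
  - by rewrite adj_irrefl.
have [m [u [v [uv Etc]]]] := cube_mean_even_cycle bK Ksym sc uc ec.
case: (eqVneq (t (cycle_edges c)) 0) => tc.
  right=> S SE Sn ev; case/set0Pn: Sn => p pS.
  rewrite Etc in tc.
  have K0 := kernel_pow_sqr_eq0 bK Ksym uv tc.
  have pE := fintype.subsetP SE _ pS.
  apply: (cube_mean_edges_weight_eq0 bK pS) => //.
    by have := oriented_edge_set pE; apply: contraTneq => ->; rewrite ltnn.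
  move=> q qS q1 q2.
  have [w w1 Eq] := oriented_orient (oS _ SE) qS q1.
  move: q2; rewrite Eq touches_orient => /orP[/eqP p21|/eqP <-].
    by have := oriented_edge_set pE; rewrite p21 ltnn.
  by rewrite /orient (oriented_edge_set pE); case: (p).
left; exists g; split=> //; exists (cycle_edges c); split=> //.
- by rewrite -card_gt0 card szc (leq_trans _ (leq_trans sc _))// -szc.
- by rewrite card.
- by rewrite card.
- by rewrite lt_neqAle eq_sym tc at_g// ?card// -card_gt0 card; exact: leq_trans sc.
Qed.

End WeaklyLocallyCommon.

Theorem theorem4p1 (R : realType) (F : sgraph) :
  no_isolated F ->
  ~ weakly_locally_common R F ->
  exists c1 c2 : seq F,
    [/\ is_cycle c1, is_cycle c2, odd (size c1), odd (size c2) &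
        (#|[set v in c1] :&: [set v in c2]| <= 1)%N] /\
    (((size c1 < size c2)%N /\
        ((size c1 + size c2)%:R%:E <= g_even R F)%E) \/
     (size c1 = size c2 /\
        ((size c1 + size c2)%:R%:E < g_even R F)%E)).
Proof.
move=> _ nwlc; apply: contrapT => concl; apply: nwlc => U [kU _].
have sec : short_even_cycles F.
  move=> c1 c2 cc1 cc2 o1 o2 n le12; apply: contrapT => no; apply: concl.
  exists c1, c2; split=> //.
  have big (c : seq F) : is_cycle c -> ~~ odd (size c) ->
      (size c1 + size c2 < size c + (size c1 < size c2))%N.
    by move=> cc ec; rewrite ltnNge; apply/negP => le; apply: no; exists c.
  case: (ltngtP (size c1) (size c2)) le12 big => // [lt _ big|eq _ big].
    left; split=> //; apply: g_even_ge => c cc ec.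
    by have := big c cc ec; rewrite /= addn1.
  right; split=> //; apply: (@lt_le_trans _ _ ((size c1 + size c2).+1%:R%:E)%E).
    by rewrite lte_fin ltr_nat.
  by apply: g_even_ge => c cc ec; have := big c cc ec; rewrite /= addn0.
pose a (S : {set F * F}) : R :=
  if [&& S \subset edge_set F, S != finset.set0 & ~~ odd #|S|]
  then 2 * cube_mean (edges_weight (ext_kernel U) S) else 0.
suff [e0 e0p He] : exists2 e0 : R, 0 < e0 & forall e, 0 <= e <= e0 ->
    0 <= \sum_(S : {set F * F}) a S * e ^+ #|S|.
  by exists e0 => // e /He; rewrite hom_density_sum// lerDl.
have := lowest_coefficient sec (bmeas_ext_kernel kU) (ext_kernel_sym kU).
move=> [[m [lt_m eq_m [S [SE S0 ev Sm tS]]]]|all0].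
  apply: (@eventually_ge0 _ _ (fun S : {set F * F} => #|S|) a m).
  - by move=> S' lt; rewrite /a; case: ifP => // /and3P[? ? ?]; rewrite lt_m ?mulr0.
  - by move=> S' eq; rewrite /a; case: ifP => // /and3P[? ? ?]; rewrite mulr_ge0// eq_m.
  - by exists S => //; rewrite /a SE S0 ev mulr_gt0.
exists 1 => // e _; rewrite big1// => S _; rewrite /a.
by case: ifP => [/and3P[? ? ?]|]; rewrite ?all0// ?mulr0 mul0r.
Qed.
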